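(* Let $r\ge 3$ and $s\ge 1$ be integers. There exist $\delta>0$ and $N>0$ such that for all integers $n_1\ge n_2\ge\dots\ge n_r$ with $n_r\ge N$ and $n_1\le(1+\delta)n_r$ the following holds. If $r\ne 4$, then $$m_0(s,n_1,\dots,n_r)=s\prod_{\ell=1}^{r-1}n_\ell-\prod_{\ell=1}^{r-1}(n_\ell-1)+n_r-s.$$ If $r=4$, then $$m_0(s,n_1,\dots,n_4)=\max\left\{s\prod_{\ell=1}^{3}n_\ell-\prod_{\ell=1}^{3}(n_\ell-1)+n_4-s,\ \ n_1\bigl(sn_2n_3-(n_2-1)(n_3-1)+n_4-s\bigr)\right\}.$$
   Context: For integers $n_1\ge\dots\ge n_r$, let $X_\ell=[n_\ell]$. An $r$-partite $r$-graph is a family $\mathcal F\subseteq X_1\times\dots\times X_r$; its vertices are the pairs $(\ell,x)$ with $x\in X_\ell$, and an edge $A=(a_1,\dots,a_r)$ contains the vertex $(\ell,x)$ iff $a_\ell=x$. Two edges $A,B$ are disjoint if $A[\ell]\ne B[\ell]$ for all $\ell$. The matching number $\nu(\mathcal F)$ is the maximum number of pairwise disjoint edges of $\mathcal F$. A transversal is a set $T$ of vertices such that every edge of $\mathcal F$ contains a vertex of $T$; $\tau(\mathcal F)$ is the minimum size of a transversal. For integers $r\ge 3$ and $n_1\ge\dots\ge n_r>s\ge 1$, $m_0(s,n_1,\dots,n_r)$ denotes the maximum of $|\mathcal F|$ over all $\mathcal F\subseteq X_1\times\dots\times X_r$ with $\nu(\mathcal F)\le s<\tau(\mathcal F)$.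 *)

(* Defs.v *)
From HB Require Import structures.
From mathcomp Require Import all_boot all_order all_algebra.
Set Implicit Arguments. Unset Strict Implicit. Unset Printing Implicit Defensive.
Import Order.TTheory GRing.Theory Num.Theory.

(* Parts are indexed by i : 'I_r (i = l-1), part i is X_{i+1} = [n i],
   represented as 'I_(n i).  An edge is a dependent function A with A i : 'I_(n i),
   i.e. an element of X_1 x ... x X_r. *)
Definition edge (r : nat) (n : nat -> nat) := {dffun forall i : 'I_r, 'I_(n i)}.

Definition vertex (r : nat) (n : nat -> nat) := {i : 'I_r & 'I_(n i)}.

Section Defs.
Variables (r : nat) (n : nat -> nat).

Definition contains (A : edge r n) (v : vertex r n) : bool :=
  A (tag v) == tagged v.

Definition disjoint_edges (A B : edge r n) : bool :=
  [forall i : 'I_r, A i != B i].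

Definition is_matching (F M : {set edge r n}) : bool :=
  (M \subset F) &&
  [forall A in M, forall B in M, (A != B) ==> disjoint_edges A B].

Definition nu (F : {set edge r n}) : nat :=
  \max_(M : {set edge r n} | is_matching F M) #|M|.

Definition is_transversal (F : {set edge r n}) (T : {set vertex r n}) : bool :=
  [forall A in F, exists v in T, contains A v].

(* transversal number: minimum size of a transversal (the full vertex set is
   always a transversal, so the default value #|vertex| is harmless) *)
Definition tau (F : {set edge r n}) : nat :=
  \big[minn/#|{: vertex r n}|]_(T : {set vertex r n} | is_transversal F T) #|T|.

End Defs.

Definition m0 (r s : nat) (n : nat -> nat) : nat :=
  \max_(F : {set edge r n} | (nu F <= s) && (s < tau F)) #|F|.

(* Main.v *)
Require Import Defs.
From HB Require Import structures.
From mathcomp Require Import all_boot all_order all_algebra.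
From mathcomp Require Import zify ring.
Import Order.TTheory GRing.Theory Num.Theory.

(** Write X = n_1 and Y = n_r. Call a vertex heavy if its degree in F exceeds
    s (r + 1) X^(r-2). Edges through distinct heavy vertices can be chosen greedily to be
    disjoint from each other and from a given matching, so F has at most s - 1 heavy
    vertices. If there are fewer, F is too small; otherwise the edges F0 avoiding them
    form an intersecting family with no one-vertex transversal.

    Extend F0 to a maximal such family. Its two-vertex transversals pairwise meet, hence form
    a triangle or a star. A triangle forces every edge to contain two of three fixed vertices.
    A star with r - 1 leaves gives a Hilton-Milner family, and a star with at most r - 2 leaves
    leaves only (r - 2) X^(r-2) + O(X^(r-3)) edges. The triangle bound coincides with the
    Hilton-Milner bound for r = 3 and is of smaller order for r >= 5, so it matters only for
    r = 4.

    Finally the edges meeting the s - 1 heavy vertices number at most (s - 1) P, with a loss of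
    at least Y^(r-2) unless all heavy vertices lie in a single part of minimal size; in that case
    F0 lives in a box where that part has lost s - 1 elements, which gives the exact value. *)

Set Implicit Arguments. Unset Strict Implicit. Unset Printing Implicit Defensive.

(** * Hilton-Milner and triangle families *)

Lemma exists_third r (i j : 'I_r) : 2 < r -> exists2 l, l != i & l != j.
Proof.
move=> r3; have /card_gt0P[l] : 0 < #|[set: 'I_r] :\ i :\ j|.
  have := cardsT 'I_r; rewrite card_ord (cardsD1 i) (cardsD1 j (_ :\ i)).
  by case: #|_ :\ j| => // /esym rE; move: r3; rewrite rE; do 2!case: (_ \in _).
by rewrite !inE andbT => /andP[]; exists l.
Qed.

Section Families.
Variables (r : nat) (n : nat -> nat).
Implicit Types (A B E : edge r n) (F : {set edge r n}) (i j k l : 'I_r).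
Implicit Types (S : forall i : 'I_r, {set 'I_(n i)}).

Definition intersecting F :=
  [forall A in F, forall B in F, [exists i, A i == B i]].

(** Says that no single vertex is a transversal, that is, [F] has transversal number at least
    two. *)
Definition nontrivial F := forall i (x : 'I_(n i)), exists2 A, A \in F & A i != x.

Definition box S : {set edge r n} := [set A : edge r n | [forall i, A i \in S i]].

Lemma boxP S A : reflect (forall i, A i \in S i) (A \in box S).
Proof. by rewrite inE; apply: forallP. Qed.

Lemma card_box S : #|box S| = \prod_i #|S i|.
Proof.
rewrite -[RHS](@cardsXn _ (fun i : 'I_r => 'I_(n i)) S).
by apply: eq_card => A; rewrite !inE.
Qed.

Lemma boxS S S' : (forall i, S i \subset S' i) -> box S \subset box S'.
Proof.
by move=> sS; apply/subsetP => A /boxP AS; apply/boxP => i; apply: (subsetP (sS i) _ (AS i)).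
Qed.

Definition upd E i (x : 'I_(n i)) : edge r n := [ffun k => dfwith E x k].

Lemma upd_in E i (x : 'I_(n i)) : upd E x i = x.
Proof. by rewrite ffunE dfwith_in. Qed.

Lemma upd_out E i (x : 'I_(n i)) l : l != i -> upd E x l = E l.
Proof. by move=> li; rewrite ffunE dfwith_out // eq_sym. Qed.

Lemma upd_box E i (x : 'I_(n i)) S :
  E \in box S -> x \in S i -> upd E x \in box S.
Proof.
move=> /boxP ES xS; apply/boxP => l.
by have [->|li] := eqVneq l i; rewrite ?upd_in ?upd_out.
Qed.

Lemma box_neq0 S : (forall i, S i != set0) -> exists A, A \in box S.
Proof.
move=> S0; have ne i : exists x, x \in S i by apply/set0Pn.
by exists [ffun i => xchoose (ne i)]; apply/boxP => i; rewrite ffunE; apply: xchooseP.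
Qed.

Lemma intersectingP F : reflect (forall A B, A \in F -> B \in F -> exists i, A i = B i)
  (intersecting F).
Proof.
apply: (iffP forall_inP) => [iF A B AF BF|iF A AF].
  by have /forall_inP/(_ B BF)/existsP[i /eqP] := iF A AF; exists i.
apply/forall_inP => B BF; apply/existsP.
by have [i ABi] := iF _ _ AF BF; exists i; apply/eqP.
Qed.

(** The partite Hilton-Milner family inside a box, with centre the vertex of [E0] in part [i]: edges
    through the centre that meet [E0] elsewhere, together with the edges off the centre that copy
    [E0] in all other parts. *)
Definition hm_family S i E0 := [set A in box S |
  if A i == E0 i then [exists l, (l != i) && (A l == E0 l)]
  else [forall l, (l != i) ==> (A l == E0 l)]].

Definition hm_size (m : 'I_r -> nat) i :=
  \prod_(l | l != i) m l - \prod_(l | l != i) (m l).-1 + (m i).-1.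

Definition tri_family S i j k E0 := [set A in box S |
  [|| (A i == E0 i) && (A j == E0 j), (A i == E0 i) && (A k == E0 k)
    | (A j == E0 j) && (A k == E0 k)]].

Definition tri_size (m : 'I_r -> nat) i j k :=
  \prod_(l | [&& l != i, l != j & l != k]) m l * (m i + m j + m k - 2).

(** The family is a difference of boxes plus a disjoint box: [S1] holds the edges through the
    centre, [S2] those among them that avoid [E0] elsewhere, and [S3] the edges off the centre, one
    for each remaining element of part [i]. *)
Lemma card_hm_family S i E0 : E0 \in box S ->
  #|hm_family S i E0| = hm_size (fun l => #|S l|) i.
Proof.
move=> /boxP E0S.
pose S1 l := if l == i then [set E0 l] else S l.
pose S2 l := if l == i then [set E0 l] else S l :\ E0 l.
pose S3 l := if l == i then S l :\ E0 l else [set E0 l].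
have -> : hm_family S i E0 = (box S1 :\: box S2) :|: box S3.
  apply/setP => A; rewrite !inE.
  apply/andP/orP => [[/forallP AS]|].
    case: eqP => [Ai /existsP[l /andP[li /eqP Al]]|/eqP Ai /forallP H].
      left; apply/andP; split.
        by apply/forallPn; exists l; rewrite /= /S2 (negPf li) !inE Al eqxx.
      by apply/forallP => k; rewrite /S1; case: (eqVneq k i) => [->|_ //]; rewrite inE Ai.
    right; apply/forallP => l; rewrite /S3; case: (eqVneq l i) => [->|li].
      by rewrite !inE Ai AS.
    by rewrite inE; have /implyP/(_ li) := H l.
  case=> [/andP[/forallPn[l]]|] .
    rewrite /S1 /S2 /= => nA2 /forallP A1.
    have Ai : A i = E0 i by have := A1 i; rewrite eqxx inE => /eqP.
    have AS l' : A l' \in S l'.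
      by have := A1 l'; case: (eqVneq l' i) => [-> _|//]; rewrite Ai E0S.
    split; first by apply/forallP.
    rewrite Ai eqxx; apply/existsP; exists l; move: nA2.
    by case: (eqVneq l i) => [->|li]; rewrite !inE ?Ai ?eqxx // AS andbT negbK.
  rewrite /S3 => /forallP A3; split.
    apply/forallP => l; have := A3 l; case: (eqVneq l i) => [_|_]; rewrite !inE.
      by case/andP.
    by move/eqP->.
  have := A3 i; rewrite eqxx !inE => /andP[/negPf-> _].
  by apply/forallP => l; apply/implyP => /negPf li; have := A3 l; rewrite li inE.
have c1 : #|box S1| = \prod_(l | l != i) #|S l|.
  rewrite card_box (bigD1 i) //= /S1 eqxx cards1 mul1n.
  by apply: eq_bigr => l /negPf->.
have c2 : #|box S2| = \prod_(l | l != i) #|S l|.-1.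
  rewrite card_box (bigD1 i) //= /S2 eqxx cards1 mul1n.
  by apply: eq_bigr => l /negPf->; rewrite (cardsD1 (E0 l) (S l)) E0S.
have c3 : #|box S3| = #|S i|.-1.
  rewrite card_box (bigD1 i) //= /S3 eqxx big1 ?muln1.
    by rewrite (cardsD1 (E0 i) (S i)) E0S.
  by move=> l /negPf->; rewrite cards1.
have s21 : box S2 \subset box S1.
  apply: boxS => l; rewrite /S1 /S2; case: (eqVneq l i) => // _.
  exact: subsetDl.
rewrite cardsU (_ : _ :&: _ = set0); last first.
  apply/setP => A; rewrite !inE; apply/negP => /andP[/andP[_ /forallP A1] /forallP A3].
  by have := A1 i; have := A3 i; rewrite /S1 /S3 eqxx !inE => /andP[/negPf->].
by rewrite cards0 subn0 cardsD (setIidPr s21) c1 c2 c3.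
Qed.

(** The family splits into three disjoint boxes: agreement with [E0] at [i] and [j]; at [i] and [k]
    but not [j]; at [j] and [k] but not [i]. The two exclusions account for the [- 2] in
    [tri_size]. *)
Lemma card_tri_family S i j k E0 : i != j -> i != k -> j != k ->
  E0 \in box S -> #|tri_family S i j k E0| = tri_size (fun l => #|S l|) i j k.
Proof.
move=> ij ik jk /boxP E0S.
pose S1 l := if (l == i) || (l == j) then [set E0 l] else S l.
pose S2 l := if (l == i) || (l == k) then [set E0 l] else
  if l == j then S l :\ E0 l else S l.
pose S3 l := if (l == j) || (l == k) then [set E0 l] else
  if l == i then S l :\ E0 l else S l.
have ji : j != i by rewrite eq_sym.
have ki : k != i by rewrite eq_sym.
have kj : k != j by rewrite eq_sym.
have neq := (negPf ij, negPf ik, negPf jk, negPf ji, negPf ki, negPf kj, eqxx, orbT, orbF).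
have -> : tri_family S i j k E0 = box S1 :|: box S2 :|: box S3.
  apply/setP => A; rewrite !inE.
  apply/andP/idP => [[/forallP AS H]|].
    case Ai: (A i == E0 i) H => /=; case Aj: (A j == E0 j) => //= H.
    - apply/orP; left; apply/orP; left; apply/forallP => l; rewrite /S1.
      by case: (eqVneq l i) => [->|_] /=; rewrite ?inE //; case: (eqVneq l j) => [->|_] /=; rewrite ?inE ?AS.
    - apply/orP; left; apply/orP; right; apply/forallP => l; rewrite /S2.
      have Ak : A k == E0 k by move: H; rewrite orbF.
      case: (eqVneq l i) => [->|_] /=; rewrite ?inE //.
      case: (eqVneq l k) => [->|_] /=; rewrite ?inE //.
      by case: (eqVneq l j) => [->|_] /=; rewrite ?inE ?Aj ?AS.
    - apply/orP; right; apply/forallP => l; rewrite /S3.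
      case: (eqVneq l j) => [->|_] /=; rewrite ?inE //.
      case: (eqVneq l k) => [->|_] /=; rewrite ?inE //.
      by case: (eqVneq l i) => [->|_] /=; rewrite ?inE ?Ai ?AS.
  move=> H.
  have sub (S' : forall i : 'I_r, {set 'I_(n i)}) : (forall l, S' l \subset S l) ->
      (forall l, A l \in S' l) -> [forall l, A l \in S l].
    by move=> SS AS; apply/forallP => l; apply: (subsetP (SS l) _ (AS l)).
  case/orP: H => [/orP[]|] /forallP H; split.
  - apply: sub H => l; rewrite /S1; case: ifP => // _; by rewrite sub1set E0S.
  - have := H i; have := H j; rewrite /S1 !neq /= !inE => -> -> //.
  - apply: sub H => l; rewrite /S2; case: ifP => [_|_]; first by rewrite sub1set E0S.
    by case: ifP => // _; apply: subsetDl.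
  - have := H i; have := H k; rewrite /S2 !neq /= !inE => -> ->; by rewrite orbT.
  - apply: sub H => l; rewrite /S3; case: ifP => [_|_]; first by rewrite sub1set E0S.
    by case: ifP => // _; apply: subsetDl.
  - have := H j; have := H k; rewrite /S3 !neq /= !inE => -> ->; by rewrite !orbT.
have sz (S' : forall i : 'I_r, {set 'I_(n i)}) :
    (forall l, l != i -> l != j -> l != k -> S' l = S l) ->
    #|box S'| = #|S' i| * (#|S' j| * (#|S' k| *
      \prod_(l | [&& l != i, l != j & l != k]) #|S l|)).
  move=> SS; rewrite card_box (bigD1 i) //= (bigD1 j) //= (bigD1 k) /= ?ki //.
  congr (_ * (_ * (_ * _))).
  rewrite (eq_bigl (fun l => [&& l != i, l != j & l != k])) => [|l]; last by rewrite andbA.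
  by apply: eq_bigr => l /and3P[*]; rewrite SS.
have c1 : #|box S1| = #|S k| * \prod_(l | [&& l != i, l != j & l != k]) #|S l|.
  rewrite sz /S1 ?neq ?cards1 ?mul1n // => l /negPf-> /negPf-> //.
have pc l : #|S l :\ E0 l| = #|S l|.-1 by rewrite (cardsD1 (E0 l) (S l)) E0S.
have c2 : #|box S2| = #|S j|.-1 * \prod_(l | [&& l != i, l != j & l != k]) #|S l|.
  rewrite sz /S2 ?neq ?cards1 ?mul1n ?pc //= => l /negPf-> /negPf-> /negPf-> //.
have c3 : #|box S3| = #|S i|.-1 * \prod_(l | [&& l != i, l != j & l != k]) #|S l|.
  rewrite sz /S3 ?neq ?cards1 ?mul1n ?pc //= => l /negPf-> /negPf-> /negPf-> //.
rewrite cardsU (_ : _ :&: box S3 = set0); last first.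
  apply/setP => A; rewrite !inE; apply/negP => /andP[+ /forallP A3].
  have := A3 i; rewrite /S3 !neq !inE => /andP[/negPf Ai _].
  by case/orP=> /forallP /(_ i); rewrite /S1 /S2 !neq inE Ai.
rewrite cardsU (_ : _ :&: box S2 = set0); last first.
  apply/setP => A; rewrite !inE; apply/negP => /andP[/forallP/(_ j) + /forallP/(_ j)].
  by rewrite /S1 /S2 !neq !inE => ->.
rewrite cards0 !subn0 c1 c2 c3 /tri_size -!mulnDl mulnC; congr (_ * _).
have p l : 0 < #|S l| by apply/card_gt0P; exists (E0 l); apply: E0S.
have := p i; have := p j; have := p k; clear; lia.
Qed.

Lemma hm_intersecting S i E0 : (exists l, l != i) -> intersecting (hm_family S i E0).
Proof.
case=> l0 l0i; apply/intersectingP => A B; rewrite !inE => /andP[_ HA] /andP[_ HB].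
move: HA HB; case: eqP => [Ai HA|_ HA]; case: eqP => [Bi HB|_ HB].
- by exists i; rewrite Ai Bi.
- have /existsP[l /andP[li /eqP Al]] := HA; exists l.
  by have /forallP/(_ l)/implyP/(_ li)/eqP-> := HB.
- have /existsP[l /andP[li /eqP Al]] := HB; exists l.
  by have /forallP/(_ l)/implyP/(_ li)/eqP-> := HA.
- exists l0; have /forallP/(_ l0)/implyP/(_ l0i)/eqP-> := HA.
  by have /forallP/(_ l0)/implyP/(_ l0i)/eqP-> := HB.
Qed.

Lemma tri_intersecting S i j k E0 : intersecting (tri_family S i j k E0).
Proof.
apply/intersectingP => A B; rewrite !inE => /andP[_ HA] /andP[_ HB].
have [/andP[/eqP a /eqP b]|ni] := boolP ((A i == E0 i) && (B i == E0 i)).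
  by exists i; rewrite a b.
have [/andP[/eqP a /eqP b]|nj] := boolP ((A j == E0 j) && (B j == E0 j)).
  by exists j; rewrite a b.
have [/andP[/eqP a /eqP b]|nk] := boolP ((A k == E0 k) && (B k == E0 k)).
  by exists k; rewrite a b.
by move: HA HB ni nj nk; do 6!case: (_ == _).
Qed.

(** A one-vertex transversal would have to be a vertex of [E0]; changing [E0] in that single part
    gives an edge of [F] that misses it. *)
Lemma nontrivial_of_upd F E0 S : (forall l, 1 < #|S l|) -> E0 \in F ->
  (forall l (y : 'I_(n l)), y \in S l -> y != E0 l -> upd E0 y \in F) -> nontrivial F.
Proof.
move=> S2 E0F updF l x; have [<-|ne] := eqVneq (E0 l) x; last by exists E0.
have /card_gt0P[y] : 0 < #|S l :\ E0 l|.
  have := S2 l; rewrite (cardsD1 (E0 l) (S l)); case: #|_ :\ _| => // [].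
  by case: (E0 l \in _).
rewrite !inE => /andP[y0 yS]; exists (upd E0 y); first exact: updF.
by rewrite upd_in.
Qed.

Lemma hm_nontrivial S i E0 : 2 < r -> (forall l, 1 < #|S l|) -> E0 \in box S ->
  nontrivial (hm_family S i E0).
Proof.
move=> r3 S2 E0S.
have ex j : exists2 l, l != i & l != j by exact: exists_third.
apply: (nontrivial_of_upd S2 (E0 := E0)).
  by rewrite inE E0S eqxx; apply/existsP; have [l li _] := ex i; exists l; rewrite li eqxx.
move=> l y yS yE; rewrite inE upd_box //=.
have [li|il] := eqVneq l i.
  subst l; rewrite upd_in (negPf yE); apply/forallP => l; apply/implyP => li.
  by rewrite upd_out.
rewrite upd_out 1?eq_sym // eqxx; apply/existsP; have [l' l'i l'l] := ex l.
by exists l'; rewrite l'i upd_out ?eqxx.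
Qed.

Lemma tri_nontrivial S i j k E0 : i != j -> i != k -> j != k ->
  (forall l, 1 < #|S l|) -> E0 \in box S -> nontrivial (tri_family S i j k E0).
Proof.
move=> ij ik jk S2 E0S; apply: (nontrivial_of_upd S2 (E0 := E0)).
  by rewrite inE E0S !eqxx.
move=> l y yS yE; rewrite inE upd_box //=.
have [il|] := eqVneq l i; first by subst l; rewrite !(@upd_out _ _ _ j) ?(@upd_out _ _ _ k) ?eqxx ?orbT // eq_sym.
have [jl|] := eqVneq l j; first by subst l; rewrite !(@upd_out _ _ _ i) ?(@upd_out _ _ _ k) ?eqxx ?orbT // eq_sym.
by rewrite ![l == _]eq_sym => *; rewrite !(@upd_out _ _ _ i) ?(@upd_out _ _ _ j) ?eqxx.
Qed.

End Families.

(** * Maximal intersecting families *)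

Lemma card_bigcup_leq (I T : finType) (P : pred I) (G : I -> {set T}) :
  #|\bigcup_(i | P i) G i| <= \sum_(i | P i) #|G i|.
Proof.
elim/big_ind2: _ => [|m A p B mA pB|//]; first by rewrite cards0.
by apply: leq_trans (leq_add mA pB); apply: leq_card_setU.
Qed.

Lemma card_bigcup_leq_const (I T : finType) (A : {pred I}) (G : I -> {set T}) c :
  {in A, forall i, #|G i| <= c} -> #|\bigcup_(i in A) G i| <= #|A| * c.
Proof.
move=> Gc; apply: leq_trans (card_bigcup_leq _ _) _.
by rewrite -sum_nat_const; apply: leq_sum.
Qed.

Section Intersecting.
Variables (r : nat) (n : nat -> nat).
Implicit Types (A B E : edge r n) (F : {set edge r n}) (i j k l : 'I_r).
Implicit Types (S : forall i : 'I_r, {set 'I_(n i)}) (u v w : vertex r n).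

Definition vtx A i : vertex r n := Tagged (fun i : 'I_r => 'I_(n i)) (A i).

Lemma containsP A v : reflect (v = vtx A (tag v)) (contains A v).
Proof.
case: v => i x; rewrite /contains /vtx /=; apply: (iffP eqP) => [<- //|].
by move/eqP; rewrite -tag_eqE /tag_eq /= eqxx tagged_asE => /eqP.
Qed.

Lemma contains_vtx A B i : contains A (vtx B i) = (A i == B i).
Proof. by []. Qed.

Lemma card_agree (J : {set 'I_r}) E :
  #|[set A : edge r n | [forall i in J, A i == E i]]| = \prod_(i | i \notin J) n i.
Proof.
pose S i := if i \in J then [set E i] else setT.
rewrite (_ : [set _ | _] = box S).
  rewrite card_box (bigID (mem J)) /= big1 ?mul1n; last first.
    by move=> i iJ; rewrite /S iJ cards1.
  by apply: eq_bigr => i /negPf iJ; rewrite /S iJ cardsT card_ord.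
apply/setP => A; rewrite !inE; apply: eq_forallb => i; rewrite /S.
by case: (i \in J); rewrite inE.
Qed.

Lemma card_agree_leq (J : {set 'I_r}) E X : (forall i, n i <= X) ->
  #|[set A : edge r n | [forall i in J, A i == E i]]| <= X ^ (r - #|J|).
Proof.
move=> nX; have -> : r - #|J| = #|~: J| by rewrite [RHS]cardsCs setCK card_ord.
rewrite card_agree.
rewrite -prod_nat_const (eq_bigl (mem (~: J))) => [|i]; last by rewrite !inE.
exact: leq_prod.
Qed.

Lemma card_pair_leq u v X : (forall i, n i <= X) -> tag u != tag v ->
  #|[set A : edge r n | contains A u && contains A v]| <= X ^ (r - 2).
Proof.
move=> nX uv; have [->|/set0Pn[E]] := eqVneq [set A : edge r n | contains A u && contains A v] set0.
  by rewrite cards0.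
rewrite inE => /andP[/containsP-> /containsP->].
have -> : 2 = #|[set tag u; tag v]| by rewrite cards2 uv.
apply: leq_trans (card_agree_leq _ E nX); apply: subset_leq_card.
apply/subsetP => A; rewrite !inE !contains_vtx => /andP[Au Av].
by apply/forall_inP => i; rewrite !inE => /orP[]/eqP->.
Qed.

Lemma card_triple_leq u v w X : (forall i, n i <= X) ->
  tag u != tag v -> tag u != tag w -> tag v != tag w ->
  #|[set A : edge r n | [&& contains A u, contains A v & contains A w]]| <= X ^ (r - 3).
Proof.
move=> nX uv uw vw.
have [->|/set0Pn[E]] := eqVneq [set A : edge r n | [&& contains A u, contains A v & contains A w]] set0.
  by rewrite cards0.
rewrite inE => /and3P[/containsP-> /containsP-> /containsP->].
have -> : 3 = #|[set tag u; tag v; tag w]|.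
  by rewrite setUC cardsU1 cards2 uv !inE negb_or ![tag w == _]eq_sym uw vw.
apply: leq_trans (card_agree_leq _ E nX); apply: subset_leq_card.
apply/subsetP => A; rewrite !inE !contains_vtx => /and3P[Au Av Aw].
by apply/forall_inP => i; rewrite !inE => /orP[/orP[]|]/eqP->.
Qed.

(* In a maximal intersecting family any two transversals of size two, each consisting of
   vertices of different parts, have a common vertex; so they form a star or a triangle,
   and the edges containing none of them are negligible. *)
Section Maximal.
Variables (F : {set edge r n}) (S : forall i : 'I_r, {set 'I_(n i)}) (X : nat).
Hypothesis r3 : 2 < r.
Hypothesis nX : forall i : 'I_r, n i <= X.
Hypothesis S3 : forall l, 3 <= #|S l|.
Hypothesis FS : F \subset box S.
Hypothesis iF : intersecting F.
Hypothesis ntF : nontrivial F.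
Hypothesis maxF :
  forall E, E \in box S -> (forall A, A \in F -> exists i, E i = A i) -> E \in F.

Definition cover2 u v :=
  (tag u != tag v) && [forall A in F, contains A u || contains A v].

Lemma cover2P u v A : cover2 u v -> A \in F -> ~~ contains A u -> contains A v.
Proof. by case/andP=> _ /forall_inP H /H; case: contains. Qed.

Lemma cover2C u v : cover2 u v = cover2 v u.
Proof.
by rewrite /cover2 eq_sym; congr (_ && _); apply: eq_forallb => A; rewrite orbC.
Qed.

Lemma nontrivial_vertex u : exists2 A, A \in F & ~~ contains A u.
Proof. exact: (ntF (tagged u)). Qed.

(** Some edge of [F] misses [v], hence contains [u], and that edge lies in the box. *)
Lemma cover2_box u v : cover2 u v -> tagged u \in S (tag u).
Proof.
rewrite cover2C => cvu; have [A AF nAv] := nontrivial_vertex v.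
have /eqP <- := cover2P cvu AF nAv.
by have /boxP := subsetP FS _ AF; apply.
Qed.

(** If the two pairs were disjoint, some edge of the box would contain [u] and [v] and avoid [u']
    and [v']. It meets every edge of [F] since [u], [v] cover [F], so maximality puts it into [F],
    where it contradicts that [u'], [v'] cover [F]. *)
Lemma cover2_meet u v u' v' : cover2 u v -> cover2 u' v' ->
  [|| u == u', u == v', v == u' | v == v'].
Proof.
move=> cuv cuv'; apply/negPn/negP; rewrite !negb_or => /and4P[uu uv vu vv].
have tuv : tag u != tag v by case/andP: cuv.
pose T l (x : 'I_(n l)) : vertex r n := Tagged (fun i : 'I_r => 'I_(n i)) x.
pose S' l := [set x in S l | [&& T l x != u', T l x != v',
  (l == tag u) ==> (T l x == u) & (l == tag v) ==> (T l x == v)]].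
have S'n l : S' l != set0.
  apply/set0Pn.
  have [->|lu] := eqVneq l (tag u).
    exists (tagged u); rewrite inE (cover2_box cuv) /= (negPf tuv) implyFb andbT.
    by rewrite /T !taggedK uu uv !eqxx.
  have [->|lv] := eqVneq l (tag v).
    exists (tagged v); rewrite inE (@cover2_box v u) /=; last by rewrite cover2C.
    by rewrite [tag v == tag u]eq_sym (negPf tuv) implyFb /T !taggedK vu vv !eqxx.
  have /existsP[x /andP[xS H]] : [exists x in S l, T l x \notin [set u'; v']].
    case: (boolP [exists x in S l, T l x \notin [set u'; v']]) => //; rewrite negb_exists => /forallP H.
    have := S3 l; rewrite -(card_imset (S l) (f := T l)) => [|x y /eqP]; last first.
      by rewrite -tag_eqE /tag_eq /= eqxx tagged_asE => /eqP.
    rewrite ltnNge => /negP[]; apply: leq_trans (_ : #|[set u'; v']| <= 2).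
      apply/subset_leq_card/subsetP => _ /imsetP[x xS ->].
      by have := H x; rewrite xS /= negbK.
    by rewrite cards2; case: (_ != _).
  exists x; rewrite inE xS (negPf lu) (negPf lv) /= !andbT.
  by move: H; rewrite !inE negb_or.
have [E /boxP ES'] := box_neq0 S'n.
have ES l : [/\ E l \in S l, vtx E l != u', vtx E l != v',
    l = tag u -> vtx E l = u & l = tag v -> vtx E l = v].
  have := ES' l; rewrite inE => /and5P[? ? ? /implyP Hu /implyP Hv]; split=> //.
    by move/eqP/Hu/eqP.
  by move/eqP/Hv/eqP.
have EF : E \in F.
  apply: maxF; first by apply/boxP => l; case: (ES l).
  move=> A AF; have [/eqP Au|/(cover2P cuv AF)/eqP Av] := boolP (contains A u).
    exists (tag u); rewrite Au; have [_ _ _ /(_ erefl) <-] := ES (tag u); by [].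
  exists (tag v); rewrite Av; have [_ _ _ _ /(_ erefl) <-] := ES (tag v); by [].
have [/containsP Eu|/(cover2P cuv' EF)/containsP Ev] := boolP (contains E u').
  by have [_ + _ _ _] := ES (tag u'); rewrite -Eu eqxx.
by have [_ _ + _ _] := ES (tag v'); rewrite -Ev eqxx.
Qed.

(** Take one covering pair [u], [v]. If neither is the centre of a star, there are covering pairs
    [u], [w] with [w] other than [v], and [v], [w'] with [w'] other than [u]; these meet only if [w]
    equals [w'], which closes the triangle. *)
Lemma star_or_triangle :
  (exists u, forall v w, cover2 v w -> (v == u) || (w == u)) \/
  (exists u v w, [/\ cover2 u v, cover2 u w & cover2 v w]).
Proof.

have [/existsP[u /existsP[v cuv]]|] := boolP [exists u, exists v, cover2 u v]; last first.
  (* Without any covering pair every vertex is vacuously a centre. *)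
  move=> H; left; pose i0 := Ordinal (ltn_trans (isT : 0 < 2) r3).
  have /card_gt0P[x _] : 0 < #|S i0| by apply: leq_trans (S3 i0).
  exists (Tagged (fun i : 'I_r => 'I_(n i)) x) => v w cvw; case/negP: H.
  by apply/existsP; exists v; apply/existsP; exists w.
have [/forallP su|] := boolP [forall v, forall w, cover2 v w ==> (v == u) || (w == u)].
  by left; exists u => w w'; apply/implyP; apply: (forallP (su w)).
have [/forallP sv _|] := boolP [forall u, forall w, cover2 u w ==> (u == v) || (w == v)].
  by left; exists v => w w'; apply/implyP; apply: (forallP (sv w)).
rewrite negb_forall => /existsP[a]; rewrite negb_forall => /existsP[b].
rewrite negb_imply negb_or => /and3P[cab av bv].
rewrite negb_forall => /existsP[c]; rewrite negb_forall => /existsP[d].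
rewrite negb_imply negb_or => /and3P[ccd cu du]; right.
have {a b cab av bv} [w [cuw wv]] : exists w, cover2 u w /\ w != v.
  have := cover2_meet cuv cab; rewrite ![v == _]eq_sym (negPf av) (negPf bv) /= orbF.
  case/orP=> /eqP uE; first by exists b; rewrite uE.
  by exists a; rewrite uE cover2C.
have {c d ccd cu du} [w' [cvw wu]] : exists w, cover2 v w /\ w != u.
  have := cover2_meet cuv ccd; rewrite ![u == _]eq_sym (negPf cu) (negPf du) /=.
  case/orP=> /eqP uE; first by exists d; rewrite uE.
  by exists c; rewrite uE cover2C.
exists u, v, w; split=> //.
have uv : u != v by apply: contraTneq cuv => ->; rewrite /cover2 eqxx.
have := cover2_meet cuw cvw.
by rewrite (negPf uv) [u == _]eq_sym (negPf wu) (negPf wv) /= => /eqP->.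
Qed.

Lemma card_triangle u v w : cover2 u v -> cover2 u w -> cover2 v w ->
  #|F| <= tri_size (fun l => #|S l|) (tag u) (tag v) (tag w).
Proof.
move=> cuv cuw cvw; have [A AF nAw] := nontrivial_vertex w.
have tuv : tag u != tag v by case/andP: cuv.
have tuw : tag u != tag w by case/andP: cuw.
have tvw : tag v != tag w by case/andP: cvw.
have /eqP Au : contains A u by rewrite cover2C in cuw; apply: cover2P nAw.
have /eqP Av : contains A v by rewrite cover2C in cvw; apply: cover2P nAw.
(* [A] misses [w], so it contains [u] and [v]; moving it onto [w] gives a reference edge through all
   three vertices. *)
have ES : upd A (tagged w) \in box S.
  by apply: upd_box; [apply: (subsetP FS) | apply: (@cover2_box w u); rewrite cover2C].
rewrite -(card_tri_family tuv tuw tvw ES); apply/subset_leq_card/subsetP => B BF.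
rewrite inE (subsetP FS) //= upd_in !upd_out // Au Av -!/(contains B _).
move: cuv cuw cvw => /andP[_ /forall_inP/(_ B BF)+] /andP[_ /forall_inP/(_ B BF)+] /andP[_ /forall_inP/(_ B BF)].
by do 3!case: contains.
Qed.

(** Fix an edge [B] missing the centre [u]. Every covering pair consists of [u] and a vertex of [B],
    so the leaves are indexed by the set [J] of parts. If all parts other than that of [u] occur,
    [F] lies in a Hilton-Milner family; otherwise at most [r - 2] leaves remain and a branching
    argument bounds [F]. *)
Lemma card_star u : (forall v w, cover2 v w -> (v == u) || (w == u)) ->
  #|F| <= hm_size (fun l => #|S l|) (tag u) \/
  #|F| <= (r - 2) * X ^ (r - 2) + r ^ 3 * X ^ (r - 3).
Proof.
move=> star; have [B BF nBu] := nontrivial_vertex u.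
pose J := [set j | cover2 u (vtx B j)].
have [/forallP full|] := boolP [forall l, (l != tag u) ==> (l \in J)].
  left; have [l0 l0u] : exists l, l != tag u.
    have /card_gt0P[l] : 0 < #|[set~ tag u]|.
      by rewrite cardsC1 card_ord -subn1 subn_gt0 (ltn_trans _ r3).
    by rewrite !inE; exists l.
  have uS : tagged u \in S (tag u).
    by have /implyP/(_ l0u) := full l0; rewrite inE; apply: cover2_box.
  have ES : upd B (tagged u) \in box S by rewrite upd_box // (subsetP FS).
  rewrite -(card_hm_family _ ES); apply/subset_leq_card/subsetP => A AF.
  rewrite inE (subsetP FS) //= upd_in; case: ifP => [/eqP Au|/negbT nAu].
    have /intersectingP/(_ _ _ AF BF)[l ABl] := iF.
    have lu : l != tag u.
      by apply: contraNneq nBu => lu; rewrite /contains -Au; subst l; rewrite ABl.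
    by apply/existsP; exists l; rewrite lu upd_out // ABl eqxx.
  apply/forallP => l; apply/implyP => lu; rewrite upd_out //.
  by have /implyP/(_ lu) := full l; rewrite inE => c; apply: (cover2P c AF).
rewrite negb_forall => /existsP[j1]; rewrite negb_imply => /andP[j1u j1J]; right.
have cJ : #|J| <= r - 2.
  have <- : #|~: [set tag u; j1]| = r - 2.
    by rewrite cardsCs setCK card_ord cards2 eq_sym j1u.
  apply/subset_leq_card/subsetP => j jJ; rewrite !inE negb_or.
  apply/andP; split; last by apply: contraNneq j1J => <-.
  by move: jJ; rewrite inE => /andP[]; rewrite eq_sym.
(* Branching: an edge [A] meets [B] in some part [i], then meets [Bf i], which misses that vertex,
   in some part [j]. If these two vertices do not cover [F], then [A] also meets an edge [Cf (i, j)]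
   missing both, in a third part. *)
have /fin_all_exists[Bf HB] : forall i, exists A, A \in F /\ A i != B i.
  by move=> i; have [A AF AB] := ntF (B i); exists A.
have /fin_all_exists[Cf HC] : forall p : 'I_r * 'I_r, exists C,
    p.1 != p.2 -> ~~ cover2 (vtx B p.1) (vtx (Bf p.1) p.2) ->
    [/\ C \in F, C p.1 != B p.1 & C p.2 != Bf p.1 p.2].
  move=> [i j] /=; have [ij|] := eqVneq i j; first by exists B.
  move=> ij; case: (boolP (cover2 _ _)); first by exists B.
  rewrite /cover2 ij /= negb_forall => /existsP[C]; rewrite negb_imply negb_or => /and3P[*].
  by exists C.
(* [G1] collects edges through [u] and a leaf, at most [X ^ (r - 2)] for each leaf; [T] collects
   edges through the three vertices found by branching, at most [X ^ (r - 3)] for each of at most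
   [r ^ 3] triples of parts. *)
pose G1 j := [set A | contains A u && contains A (vtx B j)].
pose T (p : 'I_r * 'I_r * 'I_r) := [set A | [&& contains A (vtx B p.1.1),
  contains A (vtx (Bf p.1.1) p.1.2) & contains A (vtx (Cf p.1) p.2)]].
pose Q := [set p : 'I_r * 'I_r * 'I_r | [&& p.1.1 != p.1.2, p.1.1 != p.2 & p.1.2 != p.2]].
have FU : F \subset \bigcup_(j in J) G1 j :|: \bigcup_(p in Q) T p.
  apply/subsetP => A AF.
  have /intersectingP iP := iF.
  have [i ABi] := iP _ _ AF BF; have [BiF Bi] := HB i.
  have [j ABj] := iP _ _ AF BiF.
  have ij : i != j.
    by apply: contraNneq Bi => ij; subst j; rewrite -ABj ABi.
  have [c|nc] := boolP (cover2 (vtx B i) (vtx (Bf i) j)).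
    have [w [cw Au Aw]] : exists w, [/\ cover2 u w, contains A u & contains A w].
      case/orP: (star _ _ c) => /eqP e.
        by exists (vtx (Bf i) j); rewrite -{1 2}e; split=> //; rewrite contains_vtx ?ABi ?ABj.
      exists (vtx B i); rewrite -{1 2}e cover2C.
      by split=> //; rewrite contains_vtx ?ABi ?ABj.
    have /containsP wB := cover2P cw BF nBu.
    rewrite inE; apply/orP; left; apply/bigcupP; exists (tag w); first by rewrite inE -wB.
    by rewrite inE Au -wB.
  have [CF Ci Cj] := HC (i, j) ij nc.
  have [k ACk] := iP _ _ AF CF.
  rewrite inE; apply/orP; right; apply/bigcupP; exists (i, j, k).
    rewrite inE /= ij /=; apply/andP; split.
      by apply: contraNneq Ci => ik; subst k; rewrite -ACk ABi.
    by apply: contraNneq Cj => jk; subst k; rewrite -ACk ABj.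
  by rewrite inE !contains_vtx /= ABi ABj ACk !eqxx.
apply: leq_trans (subset_leq_card FU) _.
apply: leq_trans (leq_card_setU _ _) (leq_add _ _).
  apply: leq_trans (@card_bigcup_leq_const _ _ _ _ (X ^ (r - 2)) _) _.
    by move=> j; rewrite inE => /andP[tj _]; apply: card_pair_leq.
  by rewrite leq_mul2r cJ orbT.
apply: leq_trans (@card_bigcup_leq_const _ _ _ _ (X ^ (r - 3)) _) _.
  by move=> p; rewrite inE => /and3P[*]; apply: card_triple_leq.
rewrite leq_mul2r; apply/orP; right; apply: leq_trans (max_card _) _.
by rewrite !card_prod !card_ord !expnS muln1 mulnA.
Qed.

End Maximal.

(** [F] is enlarged to an inclusion-maximal intersecting family in the same box. Enlarging keeps it
    nontrivial, and the star-triangle dichotomy then applies. *)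
Lemma card_intersecting_cases F S X : 2 < r -> (forall i : 'I_r, n i <= X) ->
  (forall l, 3 <= #|S l|) -> F \subset box S -> intersecting F -> nontrivial F ->
  [\/ exists i, #|F| <= hm_size (fun l => #|S l|) i,
      exists i j k, [/\ i != j, i != k, j != k & #|F| <= tri_size (fun l => #|S l|) i j k]
    | #|F| <= (r - 2) * X ^ (r - 2) + r ^ 3 * X ^ (r - 3)].
Proof.
move=> r3 nX S3 FS iF ntF.
have [|G /maxsetP[/andP[GS iG] maxG] FG] :=
  @maxset_exists _ (fun G => (G \subset box S) && intersecting G) F.
  by rewrite FS.
have ntG : nontrivial G.
  by move=> i x; have [A AF Ax] := ntF i x; exists A; rewrite ?(subsetP FG).
have cl E : E \in box S -> (forall A, A \in G -> exists i, E i = A i) -> E \in G.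
  move=> ES EG; rewrite -(maxG (E |: G)) ?setU11 ?subsetU1 //.
  rewrite subUset sub1set ES GS /=; apply/intersectingP => A B.
  rewrite !inE => /orP[/eqP->|AG] /orP[/eqP->|BG].
  - by exists (Ordinal (ltn_trans (isT : 0 < 2) r3)).
  - exact: EG.
  - by have [i e] := EG _ AG; exists i; rewrite e.
  - exact: (intersectingP _ iG).
have le m : #|G| <= m -> #|F| <= m by apply: leq_trans; apply: subset_leq_card.
have [[u su]|[u [v [w [cuv cuw cvw]]]]] := star_or_triangle r3 S3 GS ntG cl.
  have [H|H] := card_star r3 nX GS iG ntG su; last by apply: Or33; apply: le.
  by apply: Or31; exists (tag u); apply: le.
apply: Or32; exists (tag u), (tag v), (tag w).
split; [by case/andP: cuv|by case/andP: cuw|by case/andP: cvw|].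
by apply: le; apply: card_triangle.
Qed.

End Intersecting.

(** * Comparison of the sizes *)

(** Bernoulli's inequality $(1-1/M)^k\ge 1-k/M$ with denominators cleared. *)
Lemma bernoulli_nat M x y k : (M - 1) * x <= M * y -> k <= M ->
  (M - k) * x ^ k <= M * y ^ k.
Proof.
move=> xy; elim: k => [|k IH] kM; first by rewrite subn0.
have {}IH := IH (ltnW kM).
have M0 : 0 < M by apply: leq_trans kM.
rewrite -(leq_pmul2l M0).
have h1 : M * ((M - k.+1) * x ^ k.+1) <= (M - k) * x ^ k * ((M - 1) * x).
  rewrite expnS.
  have -> : (M - k) * x ^ k * ((M - 1) * x) = ((M - k) * (M - 1)) * (x * x ^ k) by nia.
  rewrite mulnA leq_mul2r; apply/orP; right; nia.
apply: leq_trans h1 _; apply: leq_trans (leq_mul IH xy) _.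
by rewrite expnS; nia.
Qed.

(** The difference of the two products telescopes into [k] terms, each at least [Y.-1 ^ k.-1]. The
    induction uses $aP-(a-1)Q=a(P-Q)+Q$. *)
Lemma prod_pred_leq k (f : nat -> nat) Y : 0 < Y -> (forall l, l < k -> Y <= f l) ->
  \prod_(l < k) (f l).-1 + k * Y.-1 ^ k.-1 <= \prod_(l < k) f l.
Proof.
move=> Y0; elim: k => [|k IH] fY; first by rewrite !big_ord0.
have {}IH := IH (fun l lk => fY l (ltnW lk)).
have Q_ge : Y.-1 ^ k <= \prod_(l < k) (f l).-1.
  rewrite -[k in _ ^ k]card_ord -prod_nat_const; apply: leq_prod => l _.
  by have := fY l (ltnW (ltn_ord l)); lia.
have fk := fY k (ltnSn k).
rewrite !big_ord_recr /=; move: IH Q_ge fk.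
set P := \prod_(l < k) f l; set Q := \prod_(l < k) (f l).-1.
case: (k) => [|k'] /=; first by rewrite !expn0; nia.
rewrite expnS; set e := Y.-1 ^ k'; move: (f _) => a IH Q_ge fk.
have h1 : Y.-1 * (k'.+1 * e) <= a * (P - Q) by apply: leq_mul; lia.
have e1 : a * P = a * Q + a * (P - Q) by nia.
have e2 : a * Q = Q * a.-1 + Q by nia.
have e3 : k'.+2 * (Y.-1 * e) = Y.-1 * (k'.+1 * e) + Y.-1 * e by nia.
by rewrite [P * a]mulnC e1 e2 e3 -!addnA leq_add2l addnC leq_add.
Qed.

Section Sizes.
Variable r : nat.
Implicit Types (m : 'I_r -> nat) (i j k l : 'I_r).

Lemma eq_hm_size m m' i : m =1 m' -> hm_size m i = hm_size m' i.
Proof.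
by move=> e; rewrite /hm_size e; congr (_ - _ + _); apply: eq_bigr => l _; rewrite e.
Qed.

(** A smaller centre part gives a larger family. With [R] and [R'] the products of [m l] and of
    [(m l).-1] over the remaining parts, the two sizes differ by $(m_k-m_j)(R-R'-1)$, and a third
    part makes [R'] less than [R]. *)
Lemma hm_size_swap m j k : 2 < r -> (forall l, 0 < m l) -> m j <= m k ->
  hm_size m k <= hm_size m j.
Proof.
move=> r3 m0 jk; have [->//|neq] := eqVneq j k.
have kj : k != j by rewrite eq_sym.
rewrite /hm_size (bigD1 j neq) /= [\prod_(l | l != k) _](bigD1 j neq) /=.
rewrite (bigD1 k kj) /= [\prod_(l | l != j) _](bigD1 k kj) /=.
rewrite ![\prod_(l < r | (l != j) && _) _](eq_bigl (fun l => (l != k) && (l != j))); try by move=> l; rewrite andbC.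
set R := \prod_(l < r | _) m l; set R' := \prod_(l < r | _) (m l).-1.
have RR : R' < R.
  have [l lk lj] := exists_third k j r3.
  rewrite /R /R' (bigD1 l) ?lk //= [\prod_(l < r | _) m l](bigD1 l) ?lk //=.
  apply: (@leq_ltn_trans ((m l).-1 * \prod_(i < r | [&& i != k, i != j & i != l]) m i)).
    rewrite leq_mul2l; apply/orP; right.
    rewrite (eq_bigl (fun i => [&& i != k, i != j & i != l])) => [|i]; last by rewrite andbA.
    by apply: leq_prod => i _; apply: leq_pred.
  rewrite [X in _ < _ * X](eq_bigl (fun i => [&& i != k, i != j & i != l])) => [|i]; last by rewrite andbA.
  by rewrite ltn_mul2r prodn_cond_gt0 //= ltn_predL.
have := m0 j; have := m0 k; move: jk RR; move: (m j) (m k) R R' => a b R R' ab RR b0 a0.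
have h1 : a * R >= a.-1 * R' by apply: leq_mul; lia.
have h2 : b * R >= b.-1 * R' by apply: leq_mul; lia.
suff : a * R + b.-1 * R' + b <= b * R + a.-1 * R' + a by lia.
have [d ->] : exists d, b = a + d by exists (b - a); lia.
have -> : (a + d).-1 = a.-1 + d by lia.
rewrite !mulnDl; have : d * R'.+1 <= d * R by rewrite leq_mul2l RR orbT.
lia.
Qed.

Lemma all_three i j k l : r = 3 -> i != j -> i != k -> j != k -> [|| l == i, l == j | l == k].
Proof.
move=> r3 ij ik jk; have : l \in [set i; j; k].
  suff -> : [set i; j; k] = [set: 'I_r] by rewrite inE.
  apply/eqP; rewrite eqEcard subsetT cardsT card_ord {1}r3.
  by rewrite setUC cardsU1 cards2 ij !inE negb_or ![k == _]eq_sym ik jk.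
by rewrite !inE -orbA.
Qed.

(** Rests on the identity $ab-(a-1)(b-1)+c-1=a+b+c-2$. *)
Lemma tri_size3 m i j k : r = 3 -> i != j -> i != k -> j != k ->
  (forall l, 0 < m l) -> tri_size m i j k = hm_size m k.
Proof.
move=> r3 ij ik jk m0; have all l := all_three l r3 ij ik jk.
have prodk f : \prod_(l < r | l != k) f l = f i * f j.
  rewrite (bigD1 i) //= (bigD1 j) /= ?jk 1?eq_sym // big_pred0 ?muln1 // => l.
  by have := all l; do 3!case: eqP.
rewrite /hm_size !prodk /tri_size big_pred0 => [|l]; last by have := all l; do 3!case: eqP.
have := m0 i; have := m0 j; have := m0 k; case: (m i) (m j) (m k) => [|a] [|b] [|c] //= _ _ _.
nia.
Qed.

(** With four parts the triangle leaves exactly one part [a] free. *)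
Lemma tri_size4 m i j k : r = 4 -> i != j -> i != k -> j != k ->
  exists a, tri_size m i j k = m a * (\sum_l m l - m a - 2).
Proof.
move=> r4 ij ik jk; have c3 : #|[set i; j; k]| = 3.
  by rewrite setUC cardsU1 cards2 ij !inE negb_or ![k == _]eq_sym ik jk.
have c1 : #|~: [set i; j; k]| = 1 by rewrite cardsCs setCK card_ord c3 r4.
have /cards1P[a aE] : #|~: [set i; j; k]| == 1 by rewrite c1.
have nE l : [&& l != i, l != j & l != k] = (l == a).
  by rewrite -[RHS]in_set1 -aE !inE !negb_or andbA.
exists a; rewrite /tri_size (eq_bigl (pred1 a)) => [|l]; last exact: nE.
rewrite big_pred1_eq; congr (_ * (_ - _)).
rewrite (bigD1 i) //= (bigD1 j) 1?eq_sym //= (bigD1 k) /= ?(eq_sym k) ?ik //.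
rewrite (eq_bigl (pred1 a)) ?big_pred1_eq => [|l]; last by rewrite -andbA nE.
by lia.
Qed.

Lemma tri_size_leq m i j k X : 2 < r -> i != j -> i != k -> j != k ->
  (forall l, m l <= X) -> tri_size m i j k <= 3 * X ^ (r - 2).
Proof.
move=> r3 ij ik jk mX; rewrite /tri_size.
have le : \prod_(l | [&& l != i, l != j & l != k]) m l <= X ^ (r - 3).
  have -> : r - 3 = #|~: [set i; j; k]|.
    rewrite cardsCs setCK card_ord setUC cardsU1 cards2 ij !inE negb_or.
    by rewrite ![k == _]eq_sym ik jk.
  rewrite -prod_nat_const (eq_bigl (mem (~: [set i; j; k]))) => [|l].
    exact: leq_prod.
  by rewrite !inE !negb_or andbA.
have -> : r - 2 = (r - 3).+1 by lia.
rewrite expnS mulnA mulnC leq_mul //.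
by have := mX i; have := mX j; have := mX k; lia.
Qed.

End Sizes.

Lemma card_intersecting r n (F : {set edge r n}) (S : forall i : 'I_r, {set 'I_(n i)}) X :
  2 < r -> (forall i : 'I_r, n i <= X) ->
  (forall l, 3 <= #|S l|) -> F \subset box S -> intersecting F -> nontrivial F ->
  [\/ exists i, #|F| <= hm_size (fun l => #|S l|) i,
      r = 4 /\ exists i j k,
        [/\ i != j, i != k, j != k & #|F| <= tri_size (fun l => #|S l|) i j k]
    | #|F| <= (r - 2) * X ^ (r - 2) + r ^ 3 * X ^ (r - 3)].
Proof.
move=> r3 nX S3 FS iF ntF.
have [FX||FX] := card_intersecting_cases r3 nX S3 FS iF ntF; [exact: Or31| |exact: Or33].
case=> i [j [k [ij ik jk le]]].
have [r4|r4] := eqVneq r 4; first by apply: Or32; split=> //; exists i, j, k.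
(* For [r] at least 5 the constant 3 of [tri_size_leq] is at most [r - 2], so the triangle bound is
   absorbed by the bound for small stars. *)
have [r5|r5] := leqP 5 r.
  apply: Or33; apply: leq_trans le _; apply: leq_trans (leq_addr _ _).
  apply: leq_trans (tri_size_leq r3 ij ik jk (X := X) _) _ => [l|].
    by apply: leq_trans (nX l); rewrite -[leqRHS]card_ord max_card.
  by rewrite leq_mul2r; apply/orP; right; lia.
apply: Or31; exists k; rewrite -(tri_size3 _ ij ik jk) //; first by lia.
by move=> l; apply: leq_trans (S3 l).
Qed.

(** * Heavy vertices and matchings *)

Lemma exists_subset_card (T : finType) (A : {set T}) k : k <= #|A| ->
  exists2 B : {set T}, B \subset A & #|B| = k.
Proof.
move=> kA; have /card_gt0P[B] : 0 < #|[set B : {set T} | (B \subset A) && (#|B| == k)]|.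
  by rewrite cards_draws bin_gt0.
by rewrite inE => /andP[BA /eqP]; exists B.
Qed.

Lemma card_ord_ltn m t : t <= m -> #|[set x : 'I_m | x < t]| = t.
Proof.
move=> tm; have wi : injective (widen_ord tm) by move=> x y [/val_inj].
rewrite -[RHS]card_ord -[RHS]cardsT -[RHS](card_imset _ wi).
apply: eq_card => x; rewrite inE; apply/idP/imsetP => [xt|[y _ ->]].
  by exists (Ordinal xt) => //; apply: val_inj.
exact: (ltn_ord y).
Qed.

Section Matchings.
Variables (r : nat) (n : nat -> nat).
Implicit Types (A B E : edge r n) (F M : {set edge r n}) (i j k l : 'I_r).
Implicit Types (S : forall i : 'I_r, {set 'I_(n i)}) (u v w : vertex r n).
Implicit Types (T H : {set vertex r n}).

Lemma is_matchingP F M : reflect (M \subset F /\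
  {in M &, forall A B, A != B -> forall i, A i != B i}) (is_matching F M).
Proof.
apply: (iffP andP) => [] [MF dM]; split=> //.
  by move=> A B AM BM AB; apply/forallP; move/forall_inP: dM => /(_ _ AM)/forall_inP/(_ _ BM)/implyP; apply.
apply/forall_inP => A AM; apply/forall_inP => B BM; apply/implyP => AB.
by apply/forallP; apply: dM.
Qed.

Lemma nu_leqP F s : reflect (forall M, is_matching F M -> #|M| <= s) (nu F <= s).
Proof. exact: bigmax_leqP. Qed.

(** With at least one part the set of all vertices is itself a transversal, so the default value in
    [tau] obeys the same bound. *)
Lemma ltn_tauP F s : 0 < r ->
  reflect (forall T, Defs.is_transversal F T -> s < #|T|) (s < tau F).
Proof.
move=> r0; apply: (iffP idP) => [st T FT|H].
  apply: leq_trans st _; rewrite /tau; elim: (index_enum _) (mem_index_enum T) => // T' e IH.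
  rewrite inE big_cons => /orP[/eqP<-|/IH le]; first by rewrite FT geq_minl.
  by case: ifP => // _; apply: leq_trans le; apply: geq_minr.
rewrite /tau; elim/big_ind: _ => [|x y xs ys|T /H //]; last by rewrite leq_min xs.
rewrite -cardsT; apply: H; apply/forall_inP => A _; apply/existsP.
by exists (vtx A (Ordinal r0)); rewrite inE contains_vtx eqxx.
Qed.

Definition verts M := \bigcup_(A in M) [set vtx A i | i : 'I_r].

Lemma vtx_verts M A i : A \in M -> vtx A i \in verts M.
Proof. by move=> AM; apply/bigcupP; exists A => //; apply: imset_f. Qed.

Lemma vertsP M v : v \in verts M -> exists2 A, A \in M & contains A v.
Proof.
by case/bigcupP=> A AM /imsetP[i _ ->]; exists A; rewrite ?contains_vtx.
Qed.

Lemma card_verts M : #|verts M| <= #|M| * r.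
Proof.
apply: leq_trans (@card_bigcup_leq_const _ _ _ _ r _) _ => [A _|].
  by rewrite -[r in _ <= r]card_ord; apply: leq_imset_card.
by [].
Qed.

Lemma matching_sub F M M' : M' \subset M -> is_matching F M -> is_matching F M'.
Proof.
move=> sM /is_matchingP[MF dM]; apply/is_matchingP; split.
  exact: subset_trans MF.
by move=> A B AM BM; apply: dM; apply: (subsetP sM).
Qed.

Lemma matching_setU1 F M A : is_matching F M -> A \in F ->
  (forall B i, B \in M -> A i != B i) -> is_matching F (A |: M).
Proof.
move=> /is_matchingP[MF dM] AF AM; apply/is_matchingP; split.
  by rewrite subUset sub1set AF.
move=> B C; rewrite !inE => /orP[/eqP->|BM] /orP[/eqP->|CM] BC i.
- by rewrite eqxx in BC.
- exact: AM.
- by rewrite eq_sym AM.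
- exact: dM.
Qed.

Section Heavy.
Variables (F : {set edge r n}) (s X : nat).
Hypothesis nX : forall i : 'I_r, n i <= X.

Definition heavy v := s * r.+1 * X ^ (r - 2) < #|[set A in F | contains A v]|.

Definition avoids H A := [forall v in H, ~~ contains A v].

(** Each vertex of [T] shares at most [X ^ (r - 2)] edges with [v], and none if it lies in the same
    part. The degree of a heavy vertex exceeds the total of these losses. *)
Lemma heavy_edge v T : heavy v -> v \notin T -> #|T| <= s * r.+1 ->
  exists A, [/\ A \in F, contains A v & avoids T A].
Proof.
move=> hv vT cT; pose Bad := \bigcup_(w in T) [set A | contains A v && contains A w].
have cB : #|Bad| <= s * r.+1 * X ^ (r - 2).
  apply: leq_trans (@card_bigcup_leq_const _ _ _ _ (X ^ (r - 2)) _) _ => [w wT|].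
    have [e|] := eqVneq (tag v) (tag w); last exact: card_pair_leq.
    rewrite (_ : [set _ | _] = set0) ?cards0 //; apply/setP => A; rewrite !inE.
    apply/negP => /andP[/containsP vE /containsP wE].
    by case/negP: vT; rewrite vE e -wE.
  by rewrite leq_mul2r cT orbT.
have /subsetPn[A] : ~~ ([set A in F | contains A v] \subset Bad).
  by apply: contraL hv => /subset_leq_card le; rewrite /heavy -leqNgt (leq_trans le).
rewrite inE => /andP[AF Av] AB; exists A; split=> //.
apply/forall_inP => w wT; apply: contraNN AB => Aw.
by apply/bigcupP; exists w; rewrite // inE Av.
Qed.

Lemma heavy_matching H M : is_matching F M -> {in H, forall v, heavy v} ->
  {in M, forall A, avoids H A} -> #|M| + #|H| <= s.+1 ->
  exists2 M', is_matching F M' & #|M'| = #|M| + #|H|.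
Proof.
have [m cH] := ubnP #|H|; elim: m => // m IH in H M cH *.
have [->|/set0Pn[v vH]] := eqVneq H set0; first by exists M; rewrite ?cards0 ?addn0.
move=> mM hH aM cMH.
have cHv : #|H| = #|H :\ v|.+1 by rewrite (cardsD1 v H) vH.
have nv A : A \in M -> ~~ contains A v by move/aM/forall_inP; apply.
have [||A [AF Av aA]] := @heavy_edge v (H :\ v :|: verts M) (hH _ vH).
- rewrite !inE eqxx /=; apply/negP => /vertsP[A /nv]; by case: contains.
(* The new edge through [v] must avoid the other vertices of [H] and all vertices of [M]: at most
   [#|H :\ v| + #|M| * r] vertices, and [#|H :\ v| + #|M|] is at most [s]. *)
- apply: leq_trans (leq_card_setU _ _) _.
  apply: leq_trans (leq_add (leqnn _) (card_verts M)) _.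
  move: cMH; rewrite cHv => cMH.
  have cs : #|H :\ v| + #|M| <= s by lia.
  have : (#|H :\ v| + #|M|) * r.+1 <= s * r.+1 by rewrite leq_mul2r cs orbT.
  apply: leq_trans; rewrite mulnDl leq_add // ?leq_mul2l ?leqnSn ?orbT //.
  by rewrite leq_pmulr.
have AM : A \notin M by apply/negP => /nv; rewrite Av.
have cAM : #|A |: M| = #|M|.+1 by rewrite cardsU1 AM.
have aA' w : w \in H :\ v :|: verts M -> ~~ contains A w by apply: (forall_inP aA).
have [|||||M' mM' cM'] := IH (H :\ v) (A |: M).
- by rewrite -ltnS -cHv.
- apply: matching_setU1 => // B i BM; rewrite -contains_vtx; apply: aA'.
  by rewrite inE vtx_verts ?orbT.
- by move=> w; rewrite !inE => /andP[_ /hH].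
- move=> B; rewrite !inE => /orP[/eqP->|/aM aB]; apply/forall_inP => w wH.
    by apply: aA'; rewrite inE wH.
  by move/forall_inP: aB; apply; move: wH; rewrite !inE => /andP[].
- by rewrite cAM addSnnS -cHv.
by exists M'; rewrite // cM' cAM addSnnS -cHv.
Qed.

Hypothesis r0 : 0 < r.
Hypothesis nuF : nu F <= s.
Hypothesis tauF : s < tau F.

(** A matching of [F0] extends by one edge for each vertex of [H], so its size plus [#|H|] is at
    most [s]. As [H] is not a transversal, [F0] is nonempty and [H] has at most [s - 1] vertices.
    With exactly [s - 1], any two edges of [F0] meet, and [H] plus one vertex is still not a
    transversal. *)
Lemma heavy_structure : exists H, let F0 := [set A in F | avoids H A] in
  (#|H|.+2 <= s /\ #|F0| <= s * r * (s * r.+1 * X ^ (r - 2))) \/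
  [/\ #|H|.+1 = s, intersecting F0 & nontrivial F0].
Proof.
pose H := [set v | heavy v]; exists H => F0.
have F0F : F0 \subset F by apply/subsetP => A; rewrite inE => /andP[].
have bound M : is_matching F0 M -> #|M| + #|H| <= s.
  move=> /is_matchingP[MF dM].
  have mM : is_matching F M by apply/is_matchingP; split=> //; apply: subset_trans F0F.
  rewrite leqNgt; apply/negP => lt.
  (* [H] and [M] are cut down to a total of exactly [s.+1], the most that the greedy extension
     allows and enough to contradict [nu F <= s]. *)
  have [H' H'H cH'] := @exists_subset_card _ H (minn #|H| s.+1) (geq_minl _ _).
  have [|M' M'M cM'] := @exists_subset_card _ M (s.+1 - #|H'|); first by lia.
  have [||||M2 mM2 cM2] := @heavy_matching H' M'.
  - exact: matching_sub mM.
  - by move=> v /(subsetP H'H); rewrite inE.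
  - move=> A /(subsetP M'M)/(subsetP MF); rewrite inE => /andP[_ /forall_inP aA].
    by apply/forall_inP => v /(subsetP H'H)/aA.
  - by rewrite cM' subnK // cH' geq_minr.
  by move/nu_leqP: nuF => /(_ M2 mM2); rewrite cM2 cM' subnK ?ltnn // cH' geq_minr.
have trans T : #|T| <= s -> exists2 A, A \in F & avoids T A.
  move=> cT; have : ~~ Defs.is_transversal F T.
    by apply: contraTN cT => FT; rewrite -ltnNge; move/ltn_tauP: tauF; apply.
  rewrite negb_forall => /existsP[A]; rewrite negb_imply => /andP[AF].
  rewrite negb_exists => /forallP nA; exists A => //; apply/forall_inP => v vT.
  by have := nA v; rewrite vT.
have b0 : #|H| <= s.
  rewrite -[#|H|]add0n -(cards0 (edge r n)); apply: bound.
  by apply/is_matchingP; split=> [|A B]; rewrite ?sub0set ?inE.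
have [A0 A0F aA0] := trans H b0.
have A0F0 : A0 \in F0 by rewrite inE A0F.
have b1 : #|H|.+1 <= s.
  rewrite -add1n -(cards1 A0); apply: bound; apply/is_matchingP; split.
    by rewrite sub1set.
  by move=> A B; rewrite !inE => /eqP-> /eqP->; rewrite eqxx.
have [b2|b2] := ltnP #|H|.+1 s; [left|right]; split=> //.
(* The vertices of a maximal matching of [F0] cover [F0]. There are at most [s * r] of them, and
   none is heavy because [F0] avoids all of [H]. *)
- have [|M /maxsetP[mM maxM] _] := @maxset_exists _ (is_matching F0) set0.
    by apply/is_matchingP; split=> [|A B]; rewrite ?sub0set ?inE.
  have MF0 : M \subset F0 by case/is_matchingP: mM.
  have sub : F0 \subset \bigcup_(v in verts M) [set A in F | contains A v].
    apply/subsetP => A AF0; have AF := subsetP F0F _ AF0.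
    have [/exists_inP[B BM /existsP[i /eqP ABi]]|] :=
        boolP [exists B in M, [exists i, A i == B i]].
      apply/bigcupP; exists (vtx B i); first exact: vtx_verts.
      by rewrite inE AF contains_vtx ABi eqxx.
    rewrite negb_exists => /forallP nB.
    have AM : A \in M.
      rewrite -(maxM (A |: M)) ?setU11 ?subsetU1 //; apply: matching_setU1 => // B i BM.
      by have := nB B; rewrite BM /= negb_exists => /forallP; apply.
    apply/bigcupP; exists (vtx A (Ordinal r0)); first exact: vtx_verts.
    by rewrite inE AF contains_vtx eqxx.
  apply: leq_trans (subset_leq_card sub) _.
  apply: leq_trans (@card_bigcup_leq_const _ _ _ _ (s * r.+1 * X ^ (r - 2)) _) _ => [v|].
    move=> /vertsP[A /(subsetP MF0)]; rewrite inE => /andP[_ /forall_inP aA] Av.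
    by rewrite leqNgt; apply/negP => hv; have := aA v; rewrite inE Av => /(_ hv).
  rewrite leq_mul2r; apply/orP; right.
  apply: leq_trans (card_verts M) _; rewrite leq_mul2r.
  by rewrite (leq_trans (leq_addr #|H| _) (bound _ mM)) orbT.
- by apply/eqP; rewrite eqn_leq b1.
- apply/intersectingP => A B AF0 BF0.
  case: (boolP [exists i, A i == B i]) => [/existsP[i /eqP AB]|]; first by exists i.
  rewrite negb_exists => /forallP AB.
  have nAB : A != B by apply: contraTneq (AB (Ordinal r0)) => ->; rewrite eqxx.
  have /bound : is_matching F0 [set A; B].
    apply/is_matchingP; split.
      by rewrite subUset !sub1set AF0.
    move=> C D; rewrite !inE => /orP[]/eqP-> /orP[]/eqP->; rewrite ?eqxx // => _ i.
    by rewrite eq_sym.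
  by rewrite cards2 nAB; lia.
- move=> i x; pose v : vertex r n := Tagged (fun i : 'I_r => 'I_(n i)) x.
  have [|A AF aA] := trans (v |: H).
    by apply: leq_trans b1; rewrite cardsU1; case: (_ \notin _).
  have {}aA w : w \in v |: H -> ~~ contains A w by apply: (forall_inP aA).
  exists A; last exact: (aA v (setU11 _ _)).
  by rewrite inE AF; apply/forall_inP => w wH; apply: aA; rewrite inE wH orbT.
Qed.

End Heavy.

(** * Lower bound: full stars joined to an intersecting family *)

Section Construction.
Variables (i0 : 'I_r) (t : nat) (F' : {set edge r n}).
Hypothesis nt : forall i : 'I_r, t.+1 < n i.
Hypothesis F'i0 : {in F', forall A, t <= A i0}.
Hypothesis iF' : intersecting F'.
Hypothesis ntF' : nontrivial F'.

Definition full_part := [set A : edge r n | A i0 < t].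
Definition joined := full_part :|: F'.

(** Matching edges in the full part have distinct coordinates below [t] in part [i0], so there are
    at most [t]; the intersecting family adds at most one. *)
Lemma nu_joined : nu joined <= t.+1.
Proof.
apply/nu_leqP => M /is_matchingP[MF dM].
rewrite -(cardsID F' M) addnC -addn1; apply: leq_add; last first.
  apply/card_le1_eqP => A B; rewrite !inE => /andP[AM AF] /andP[BM BF].
  have [->//|AB] := eqVneq A B; have /intersectingP/(_ _ _ AF BF)[i e] := iF'.
  by have := dM _ _ AM BM AB i; rewrite e eqxx.
have tn : t <= n i0 by apply: ltnW; apply: ltnW; apply: nt.
rewrite -[leqRHS](card_ord_ltn tn).
rewrite -(@card_in_imset _ _ (fun A : edge r n => A i0)); last first.
  move=> A B; rewrite !inE => /andP[_ AM] /andP[_ BM] e.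
  by apply/eqP; apply: contraTT isT => /(dM _ _ AM BM)/(_ i0); rewrite e eqxx.
apply/subset_leq_card/subsetP => _ /imsetP[A + ->].
rewrite !inE => /andP[AF' /(subsetP MF)]; rewrite !inE (negPf AF') orbF; by [].
Qed.

(** A transversal with at most [t.+1] vertices contains every star centre: otherwise parts larger
    than [t.+1] allow an edge through that centre avoiding it. At most one vertex is then left to
    cover [F'], which is nontrivial and misses the centres. *)
Lemma tau_joined : t.+1 < tau joined.
Proof.
apply/ltn_tauP => [|T FT]; first exact: leq_trans (ltn_ord i0).
rewrite ltnNge; apply/negP => cT.
pose tg l (x : 'I_(n l)) : vertex r n := Tagged (fun i : 'I_r => 'I_(n i)) x.
have tg_inj l : injective (tg l).
  by move=> x y /eqP; rewrite -tag_eqE /tag_eq /= eqxx tagged_asE => /eqP.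
have hit A : A \in joined -> exists2 v, v \in T & contains A v.
  by move=> AF; have /exists_inP := forall_inP FT A AF.
have T1T (x : 'I_(n i0)) : x < t -> tg i0 x \in T.
  move=> xt; apply/negPn/negP => nxT.
  pose S l := [set y : 'I_(n l) | (tg l y \notin T) && ((l == i0) ==> (tg l y == tg i0 x))].
  have [l|A /boxP AS] := @box_neq0 r n S.
    apply/set0Pn; have [->|li0] := eqVneq l i0.
      by exists x; rewrite inE nxT !eqxx.
    have /subsetPn[y _ yT] : ~~ ([set: 'I_(n l)] \subset [set y | tg l y \in T]).
      apply: contraTN (nt l) => /subset_leq_card; rewrite cardsT card_ord -leqNgt => le.
      apply: leq_trans le _; rewrite -(card_imset _ (tg_inj l)); apply: leq_trans cT.
      by apply/subset_leq_card/subsetP => _ /imsetP[y + ->]; rewrite inE.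
    by exists y; move: yT; rewrite !inE => ->; rewrite (negPf li0).
  have [v vT /containsP vE] : exists2 v, v \in T & contains A v.
    apply: hit; rewrite !inE; have := AS i0; rewrite inE eqxx => /andP[_ /eqP/tg_inj->].
    by rewrite xt.
  have e : tg (tag v) (A (tag v)) = v by rewrite [RHS]vE.
  by have := AS (tag v); rewrite inE e vT.
pose T1 := [set tg i0 x | x in [set x : 'I_(n i0) | x < t]].
have tn : t <= n i0 by apply: ltnW; apply: ltnW; apply: nt.
have cT1 : #|T1| = t by rewrite card_imset ?card_ord_ltn //; apply: tg_inj.
have T1sub : T1 \subset T by apply/subsetP => _ /imsetP[x + ->]; rewrite inE => /T1T.
have cR : #|T :\: T1| <= 1 by rewrite cardsD (setIidPr T1sub) cT1 leq_subLR addn1.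
have x0 : 'I_(n i0) by exists 0; apply: leq_trans (nt i0).
have [v Rv] : exists v, T :\: T1 \subset [set v].
  have [->|/set0Pn[v vR]] := eqVneq (T :\: T1) set0.
    by exists (tg i0 x0); rewrite sub0set.
  exists v; apply/subsetP => w wR; rewrite inE; apply/eqP.
  by move/card_le1_eqP: cR; apply.
have [A AF' nAv] := ntF' (tagged v).
have [w wT Aw] : exists2 w, w \in T & contains A w by apply: hit; rewrite inE AF' orbT.
have [/imsetP[x]|wT1] := boolP (w \in T1).
  rewrite inE => xt e; move: Aw; rewrite e => /eqP Ax.
  by have := F'i0 AF'; rewrite Ax leqNgt xt.
have /(subsetP Rv) : w \in T :\: T1 by rewrite inE wT1.
by rewrite inE => /eqP e; move: Aw; rewrite e /contains (negPf nAv).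
Qed.

Lemma card_joined : #|joined| = t * \prod_(l | l != i0) n l + #|F'|.
Proof.
rewrite cardsU (_ : _ :&: _ = set0) ?cards0 ?subn0; last first.
  apply/setP => A; rewrite !inE; apply/negP => /andP[At /F'i0].
  by rewrite leqNgt At.
congr (_ + _).
pose S l := if l == i0 then [set x : 'I_(n l) | x < t] else setT.
rewrite (_ : full_part = box S).
  rewrite card_box (bigD1 i0) //= /S eqxx card_ord_ltn; last first.
    by apply: ltnW; apply: ltnW; apply: nt.
  by congr (_ * _); apply: eq_bigr => l /negPf->; rewrite cardsT card_ord.
apply/setP => A; rewrite !inE; apply/idP/forallP => [At l|/(_ i0)].
  by rewrite /S; case: (eqVneq l i0) => [->|_]; rewrite inE.
by rewrite /S eqxx inE.
Qed.

Lemma m0_joined : t * \prod_(l | l != i0) n l + #|F'| <= m0 r t.+1 n.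
Proof.
rewrite -card_joined /m0; apply: (leq_bigmax_cond (F := fun F : {set edge r n} => #|F|)).
by rewrite nu_joined tau_joined.
Qed.

End Construction.
End Matchings.

(** * Edges meeting the heavy vertices *)

Section Degrees.
Variables (r : nat) (n : nat -> nat) (i0 : 'I_r).
Implicit Types (A B E : edge r n) (F : {set edge r n}) (i j k l : 'I_r).
Implicit Types (u v w : vertex r n) (H : {set vertex r n}).

Let P := \prod_(l : 'I_r | l != i0) n l.
Let Y := n i0.
Hypothesis Y0 : 0 < Y.
Hypothesis nY : forall i : 'I_r, Y <= n i.

Definition hit H := [set A : edge r n | [exists v in H, contains A v]].

Lemma card_star_leq v : #|[set A | contains A v]| <= \prod_(l : 'I_r | l != tag v) n l.
Proof.
have [->|/set0Pn[E]] := eqVneq [set A : edge r n | contains A v] set0.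
  by rewrite cards0.
rewrite inE => /containsP->.
rewrite [X in _ <= X](eq_bigl (fun l => l \notin [set tag v])) => [|l]; last by rewrite inE.
rewrite -(card_agree _ E); apply: subset_leq_card.
apply/subsetP => A; rewrite !inE contains_vtx => Av.
by apply/forall_inP => i; rewrite inE => /eqP->.
Qed.

Lemma card_pair_geq u v : tag u != tag v ->
  Y ^ (r - 2) <= #|[set A : edge r n | contains A u && contains A v]|.
Proof.
move=> uv; have [l|E _] := @box_neq0 r n (fun l => [set: 'I_(n l)]).
  by rewrite -card_gt0 cardsT card_ord (leq_trans Y0).
pose E1 := upd (upd E (tagged u)) (tagged v).
have E1u : E1 (tag u) = tagged u by rewrite upd_out // upd_in.
have E1v : E1 (tag v) = tagged v by rewrite upd_in.
have -> : r - 2 = #|~: [set tag u; tag v]| by rewrite cardsCs setCK card_ord cards2 uv.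
apply: (@leq_trans #|[set A : edge r n | [forall i in [set tag u; tag v], A i == E1 i]]|).
  rewrite card_agree -prod_nat_const.
  rewrite [X in _ <= X](eq_bigl (mem (~: [set tag u; tag v]))) => [|i]; last by rewrite !inE.
  exact: leq_prod.
apply: subset_leq_card; apply/subsetP => A; rewrite !inE => /forall_inP H.
by rewrite /contains -E1u -E1v !H // !inE eqxx ?orbT.
Qed.

Lemma prod_neq_leq j : \prod_(l : 'I_r | l != j) n l <= P.
Proof.
rewrite /P; have [->//|ji] := eqVneq j i0; have ij : i0 != j by rewrite eq_sym.
rewrite (bigD1 i0 ij) [X in _ <= X](bigD1 j ji) /=.
rewrite (eq_bigl (fun l => (l != i0) && (l != j))) => [|l]; last by rewrite andbC.
by rewrite leq_mul2r nY orbT.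
Qed.

Lemma prod_neq_ltn j : Y < n j -> \prod_(l : 'I_r | l != j) n l + Y ^ (r - 2) <= P.
Proof.
rewrite /P => Yj; have ji : j != i0 by apply: contraTneq Yj => ->; rewrite ltnn.
have ij : i0 != j by rewrite eq_sym.
rewrite (bigD1 i0 ij) [X in _ <= X](bigD1 j ji) /=.
rewrite (eq_bigl (fun l => (l != i0) && (l != j))) => [|l]; last by rewrite andbC.
set R := \prod_(l < r | _) _.
have YR : Y ^ (r - 2) <= R.
  have -> : r - 2 = #|~: [set i0; j]| by rewrite cardsCs setCK card_ord cards2 ij.
  rewrite -prod_nat_const /R.
  rewrite [X in _ <= X](eq_bigl (mem (~: [set i0; j]))) => [|l]; last by rewrite !inE negb_or.
  exact: leq_prod.
apply: (@leq_trans (Y.+1 * R)); first by rewrite mulSn addnC leq_add2r.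
by rewrite leq_mul2r Yj orbT.
Qed.

Lemma prod_neq_eq (f : nat -> nat) j : n j = Y ->
  \prod_(l : 'I_r | l != j) f (n l) = \prod_(l : 'I_r | l != i0) f (n l).
Proof.
move=> jY; have [->//|ji] := eqVneq j i0; have ij : i0 != j by rewrite eq_sym.
rewrite (bigD1 i0 ij) [RHS](bigD1 j ji) /= jY; congr (_ * _).
by apply: eq_bigl => l; rewrite andbC.
Qed.

Lemma hitE H : hit H = \bigcup_(v in H) [set A | contains A v].
Proof.
apply/setP => A; rewrite inE; apply/exists_inP/bigcupP => [] [v vH].
  by exists v; rewrite ?inE.
by rewrite inE; exists v.
Qed.

Lemma card_hit_leq H : #|hit H| <= #|H| * P.
Proof.
rewrite hitE; apply: card_bigcup_leq_const => v _.
exact: leq_trans (card_star_leq v) (prod_neq_leq _).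
Qed.

(** [P] is the largest possible star. Two vertices in different parts share at least [Y ^ (r - 2)]
    edges, which are counted twice; a star in a part larger than [Y] falls short of [P] by at least
    as much. Only vertices in one part of minimal size escape the loss. *)
Lemma card_hit H : #|hit H| + Y ^ (r - 2) <= #|H| * P \/
  exists j, [/\ n j = Y, {in H, forall v, tag v = j} & #|hit H| <= #|H| * P].
Proof.
have [->|/set0Pn[u uH]] := eqVneq H set0.
  right; exists i0; split=> //; first by move=> v; rewrite inE.
  by rewrite hitE big_set0 cards0.
have cH : #|H| = #|H :\ u|.+1 by rewrite (cardsD1 u H) uH.
have [/exists_inP[v vH uv]|] := boolP [exists v in H, tag u != tag v].
  left; rewrite cH mulSn [P + _]addnC.
  pose Cu := [set A : edge r n | contains A u]; pose Cv := [set A : edge r n | contains A v].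
  (* Edges through both [u] and [v] are charged to [v] alone. *)
  have sub : hit H \subset hit (H :\ u) :|: (Cu :\: Cv).
    apply/subsetP => A; rewrite inE => /exists_inP[w wH Aw]; rewrite inE.
    have [wu|wu] := eqVneq w u; last first.
      by apply/orP; left; rewrite inE; apply/exists_inP; exists w; rewrite // !inE wu.
    subst w; have [Av|Av] := boolP (contains A v); last by rewrite !inE Aw Av orbT.
    apply/orP; left; rewrite inE; apply/exists_inP; exists v; rewrite // !inE vH andbT.
    by apply: contraNneq uv => ->.
  have le1 := subset_leq_card sub.
  have le2 := leq_trans le1 (leq_card_setU _ _).
  have le3 := card_hit_leq (H :\ u).
  have le4 : #|Cu :\: Cv| + Y ^ (r - 2) <= P.
    have := cardsID Cv Cu; have := card_pair_geq uv.
    have -> : [set A : edge r n | contains A u && contains A v] = Cu :&: Cv.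
      by apply/setP => A; rewrite !inE.
    have := leq_trans (card_star_leq u) (prod_neq_leq _); rewrite -/Cu.
    move: #|Cu :&: Cv| #|Cu :\: Cv| #|Cu| (Y ^ _) => a b c d; lia.
  apply: leq_trans (leq_add le2 (leqnn _)) _; rewrite -addnA; exact: leq_add.
rewrite negb_exists => /forallP same.
have tagH : {in H, forall v, tag v = tag u}.
  by move=> v vH; have := same v; rewrite vH /= negbK => /eqP.
have hitj : #|hit H| <= #|H| * \prod_(l : 'I_r | l != tag u) n l.
  rewrite hitE; apply: card_bigcup_leq_const => v vH.
  by rewrite -(tagH v vH); apply: card_star_leq.
have [lt|ge] := ltnP Y (n (tag u)).
  left; have := prod_neq_ltn lt; move: hitj; set D := \prod_(l < r | _) _ => hitj DP.
  apply: leq_trans (leq_add hitj (leqnn _)) _.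
  have : #|H| * (D + Y ^ (r - 2)) <= #|H| * P by rewrite leq_mul2l DP orbT.
  apply: leq_trans; rewrite mulnDr leq_add2l cH; exact: leq_pmull.
right; exists (tag u); split=> //; last exact: card_hit_leq.
by apply/eqP; rewrite eqn_leq ge nY.
Qed.

Definition side H j l := if l == j then
  [set x : 'I_(n l) | Tagged (fun i : 'I_r => 'I_(n i)) x \notin H] else setT.

Lemma card_side H j l : {in H, forall v, tag v = j} ->
  #|side H j l| = if l == j then n l - #|H| else n l.
Proof.
move=> Hj; rewrite /side; case: eqVneq => [->|_]; last by rewrite cardsT card_ord.
pose tg (x : 'I_(n j)) : vertex r n := Tagged (fun i : 'I_r => 'I_(n i)) x.
have tg_inj : injective tg.
  by move=> x y /eqP; rewrite -tag_eqE /tag_eq /= eqxx tagged_asE => /eqP.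
have -> : H = tg @: [set x | tg x \in H].
  apply/setP => v; apply/idP/imsetP => [vH|[x + ->]]; last by rewrite inE.
  have vj := Hj v vH; case: v vj vH => i x /= ij; subst i => xH.
  by exists x; rewrite // inE.
rewrite card_imset // cardsCs card_ord; congr (_ - _); apply: eq_card => x.
by rewrite !inE negbK mem_imset // inE.
Qed.

Lemma avoids_side H j A : avoids H A -> A \in box (side H j).
Proof.
move=> /forall_inP aA; apply/boxP => l; rewrite /side; case: ifP => _; rewrite inE //.
by apply: contraTN isT => /aA; rewrite contains_vtx eqxx.
Qed.

Lemma card_split F H : #|F| <= #|hit H| + #|[set A in F | avoids H A]|.
Proof.
apply: leq_trans (leq_card_setU _ _); apply/subset_leq_card/subsetP => A AF.
rewrite !inE AF /=; have [//|] := boolP [exists v in H, contains A v].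
rewrite negb_exists => /forallP nA; apply/forall_inP => v vH.
by have := nA v; rewrite vH.
Qed.

End Degrees.

(** * Extremal bounds in terms of the part sizes *)

Section Extremal.
Variables (r : nat) (n : nat -> nat) (i0 : 'I_r) (t : nat).
Implicit Types (F : {set edge r n}) (i j k l : 'I_r).

Let Y := n i0.
Let P := \prod_(l : 'I_r | l != i0) n l.
Let Q := \prod_(l : 'I_r | l != i0) (n l).-1.

Hypothesis r3 : 2 < r.
Hypothesis nY : forall i : 'I_r, Y <= n i.
Hypothesis Yt : t + 5 <= Y.

Definition shrunk j l := if l == j then n l - t else n l.

Definition upper_side l := if l == i0 then [set x : 'I_(n l) | t <= x] else setT.

Lemma card_upper_side l : #|upper_side l| = shrunk i0 l.
Proof.
rewrite /upper_side /shrunk; case: eqVneq => [->|_]; last by rewrite cardsT card_ord.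
rewrite cardsCs card_ord; congr (_ - _).
rewrite -[RHS](@card_ord_ltn (n i0)) ?(leq_trans _ Yt) ?leq_addr //.
by apply: eq_card => x; rewrite !inE -ltnNge.
Qed.

Lemma upper_side_gt1 l : 1 < #|upper_side l|.
Proof. by rewrite card_upper_side /shrunk; have := nY l; case: ifP => _; lia. Qed.

Lemma m0_geq F' : F' \subset box upper_side -> intersecting F' -> nontrivial F' ->
  t * P + #|F'| <= m0 r t.+1 n.
Proof.
move=> sF iF ntF; apply: m0_joined => // [i|A /(subsetP sF)/boxP/(_ i0)].
  by have := nY i; lia.
by rewrite /upper_side eqxx inE.
Qed.

Lemma m0_geq_hm : t * P + (P - Q) + (Y - t.+1) <= m0 r t.+1 n.
Proof.
have [l|E ES] := @box_neq0 r n upper_side.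
  by rewrite -card_gt0 (ltnW (upper_side_gt1 l)).
have := m0_geq (F' := hm_family upper_side i0 E).
rewrite card_hm_family // (eq_hm_size _ card_upper_side).
have -> : hm_size (shrunk i0) i0 = P - Q + (Y - t.+1).
  rewrite /hm_size /shrunk eqxx; congr (_ - _ + _); [| |rewrite -/Y; lia].
    by apply: eq_bigr => l /negPf->.
  by apply: eq_bigr => l /negPf->.
rewrite addnA; apply.
- by apply/subsetP => A; rewrite inE => /andP[].
- by apply: hm_intersecting; have [l li _] := exists_third i0 i0 r3; exists l.
- by apply: hm_nontrivial => // l; apply: upper_side_gt1.
Qed.

Lemma m0_geq_tri i j k : i != j -> i != k -> j != k ->
  t * P + tri_size (shrunk i0) i j k <= m0 r t.+1 n.
Proof.
move=> ij ik jk; have [l|E ES] := @box_neq0 r n upper_side.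
  by rewrite -card_gt0 (ltnW (upper_side_gt1 l)).
have := m0_geq (F' := tri_family upper_side i j k E).
rewrite card_tri_family //.
have -> : tri_size (fun l => #|upper_side l|) i j k = tri_size (shrunk i0) i j k.
  by rewrite /tri_size !card_upper_side; congr (_ * _); apply: eq_bigr => l _; rewrite card_upper_side.
apply.
- by apply/subsetP => A; rewrite inE => /andP[].
- exact: tri_intersecting.
- by apply: tri_nontrivial => // l; apply: upper_side_gt1.
Qed.

Variable X : nat.
Let rest := (r - 2) * X ^ (r - 2) + r ^ 3 * X ^ (r - 3).
Hypothesis nX : forall i : 'I_r, n i <= X.
Hypothesis rest_small : rest <= P - Q + (Y - t.+1).
Hypothesis P_large : t.+1 * r * (t.+1 * r.+1 * X ^ (r - 2)) <= P.

(** With fewer than [t] heavy vertices, [P_large] makes the rest of [F] at most one more star. With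
    exactly [t], the bound for intersecting families is applied in the full box if [card_hit] yields
    a loss, and otherwise in the box where one minimal part has lost [t] elements. *)
Lemma card_family_leq F : nu F <= t.+1 -> t.+1 < tau F ->
  [\/ #|F| <= t * P + (P - Q) + (Y - t.+1),
      r = 4 /\ exists i j k, [/\ i != j, i != k, j != k &
        #|F| + Y ^ (r - 2) <= t * P + tri_size (fun l => n l) i j k]
    | r = 4 /\ exists (i j k a : 'I_r), [/\ i != j, i != k, j != k, n a = Y &
        #|F| <= t * P + tri_size (shrunk a) i j k]].
Proof.
move=> nuF tauF; have r0 : 0 < r by apply: leq_trans r3.
have Y0 : 0 < Y by apply: leq_trans Yt; rewrite addnS.
have [H [[cH cF0]|[cH iF0 ntF0]]] := heavy_structure nX r0 nuF tauF.
  apply: Or31; apply: leq_trans (card_split F H) _.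
  apply: leq_trans (leq_add (card_hit_leq nY H) (leq_trans cF0 P_large)) _.
  rewrite -/P -mulSnr -addnA; apply: leq_trans (leq_addr _ _).
  by rewrite leq_mul2r -ltnS (leq_trans _ cH) ?orbT.
case: cH => cH; have split := card_split F H; have := card_hit Y0 nY H.
rewrite -/P -/Y cH => -[hitH|[j [nj Hj hitH]]].
  have [l||[k hk]|[r4 [i [j [k [ij ik jk tk]]]]]|rk] :=
    @card_intersecting r n [set A in F | avoids H A] (fun l => setT) X r3 nX _ _ iF0 ntF0.
  - by rewrite cardsT card_ord (leq_trans _ (nY l)) // (leq_trans _ Yt) // addnC.
  - by apply/subsetP => A _; apply/boxP => l; rewrite inE.
  - apply: Or31; have := @hm_size_swap r (fun l => n l) i0 k r3 _ (nY k).
    rewrite (@eq_hm_size _ _ (fun l => n l) k) in hk => [|l]; last by rewrite cardsT card_ord.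
    move=> /(_ (fun l => leq_trans Y0 (nY l))) /(leq_trans hk).
    rewrite {1}/hm_size -/P -/Q -/Y.
    (* The full box gives [Y.-1] where the target has [Y - t.+1]; the loss [Y ^ (r - 2)] pays for
       the excess. *)
    have : Y <= Y ^ (r - 2) by rewrite -{1}[Y]expn1 leq_pexp2l //; lia.
    move: split hitH Yt; move: #|F| #|hit H| (Y ^ _) (t * P) (P - Q) #|_| => *; lia.
  - apply: Or32; split=> //; exists i, j, k; split=> //.
    have -> : tri_size (fun l => n l) i j k = tri_size (fun l => #|[set: 'I_(n l)]|) i j k.
      rewrite /tri_size !cardsT !card_ord; congr (_ * _).
      by apply: eq_bigr => l _; rewrite cardsT card_ord.
    apply: leq_trans (leq_add split (leqnn _)) _.
    by rewrite addnAC leq_add.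
  - apply: Or31; apply: leq_trans split _; rewrite -addnA leq_add //.
      by apply: leq_trans hitH; rewrite leq_addr.
    exact: leq_trans rk rest_small.
have cS l : #|side H j l| = shrunk j l by rewrite card_side // cH.
have S3 l : 3 <= #|side H j l|.
  by rewrite cS /shrunk; have := nY l; case: ifP => _; lia.
have [|[k hk]|[r4 [i [j' [k [ij ik jk tk]]]]]|rk] :=
    @card_intersecting r n [set A in F | avoids H A] (side H j) X r3 nX S3 _ iF0 ntF0.
- by apply/subsetP => A; rewrite inE => /andP[_]; apply: avoids_side.
- apply: Or31; rewrite (eq_hm_size k cS) in hk.
  have m0 l : 0 < shrunk j l by rewrite -cS (leq_trans _ (S3 l)).
  have jk : shrunk j j <= shrunk j k.
    rewrite /shrunk eqxx nj; case: eqP => [->|_]; first by rewrite nj.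
    by rewrite (leq_trans _ (nY k)) ?leq_subr.
  have := leq_trans hk (hm_size_swap r3 m0 jk).
  have -> : hm_size (shrunk j) j = P - Q + (Y - t.+1).
    rewrite /hm_size /P /Q -(@prod_neq_eq r n i0 id j nj) -(@prod_neq_eq r n i0 predn j nj).
    congr (_ - _ + _); [| |by rewrite /shrunk eqxx nj; lia].
      by apply: eq_bigr => l /negPf lj; rewrite /shrunk lj.
    by apply: eq_bigr => l /negPf lj; rewrite /shrunk lj.
  by move=> le; apply: leq_trans split _; rewrite -addnA leq_add.
- apply: Or33; split=> //; exists i, j', k, j; split=> //.
  have <- : tri_size (fun l => #|side H j l|) i j' k = tri_size (shrunk j) i j' k.
    by rewrite /tri_size !cS; congr (_ * _); apply: eq_bigr => l _; rewrite cS.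
  by apply: leq_trans split _; rewrite leq_add.
apply: Or31; apply: leq_trans split _; rewrite -addnA leq_add //.
exact: leq_trans rk rest_small.
Qed.

End Extremal.

(** * Numerical estimates *)

Lemma prod_neq_max q (f : nat -> nat) :
  \prod_(l < q.+1 | l != ord_max) f l = \prod_(l < q) f l.
Proof.
rewrite big_mkcond big_ord_recr /= eqxx muln1; apply: eq_bigr => l _.
by rewrite -(inj_eq val_inj) /= neq_ltn ltn_ord.
Qed.

Section Numeric.
Variables (q t X Y M : nat) (n : nat -> nat).
Hypothesis Y0 : 0 < Y.
Hypothesis nY : forall l, l < q.+2 -> Y <= n l.
Hypothesis XM : (M - 1) * X <= M * Y.-1.
Hypothesis M_large : 2 * q.+1 * q.+2 <= M.

(** By [prod_pred_leq] and Bernoulli the difference is at least $(q+2)(1-(q+1)/M)X^{q+1}$, and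
    [M_large] makes this at least $(q+3/2)X^{q+1}$. The spare half of $X^{q+1}$ absorbs the
    lower-order terms. *)
Lemma rest_leq : 2 * (q.+3 ^ 3 + t.+1) <= X ->
  q.+1 * X ^ q.+1 + q.+3 ^ 3 * X ^ q + t.+1 <=
  \prod_(l < q.+2) n l - \prod_(l < q.+2) (n l).-1.
Proof.
move=> XK; have := prod_pred_leq Y0 nY; rewrite -leq_subRL; last first.
  by apply: leq_prod => l _; apply: leq_pred.
apply: leq_trans.
have qM : q.+1 <= M by nia.
have M0 : 0 < M by lia.
have := bernoulli_nat XM qM.
rewrite [q.+2.-1]/=; set y := Y.-1 ^ q.+1; set x := X ^ q.+1 => bern.
have xE : x = X * X ^ q by rewrite /x expnS.
have xq0 : 0 < X ^ q by rewrite expn_gt0; apply/orP; left; lia.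
have h1 : (2 * q.+1).+1 * x <= 2 * q.+2 * y.
  rewrite -(leq_pmul2l M0).
  apply: (@leq_trans (2 * q.+2 * ((M - q.+1) * x))).
    rewrite !mulnA leq_mul2r; apply/orP; right; nia.
  by rewrite [X in _ <= X]mulnCA leq_mul2l bern orbT.
have h2 : 2 * (q.+3 ^ 3 + t.+1) * X ^ q <= x by rewrite xE leq_mul2r XK orbT.
have h3 : t.+1 <= t.+1 * X ^ q by rewrite leq_pmulr.
rewrite -(leq_pmul2l (isT : 0 < 2)) [X in _ <= X]mulnA; apply: leq_trans h1.
move: h2 h3; rewrite mulnDr mulnDl; move: (q.+3 ^ 3) (X ^ q) (x) => a b c; nia.
Qed.

(** The product is at least $XY^{q+1}$, and Bernoulli gives $Y^{q+1}\ge X^{q+1}/2$. *)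
Lemma prod_large K : n 0 = X -> 2 * K <= X -> K * X ^ q.+1 <= \prod_(l < q.+2) n l.
Proof.
move=> nX0 KX; rewrite big_ord_recl /= nX0.
have le : Y ^ q.+1 <= \prod_(l < q.+1) n (bump 0 l).
  rewrite -[in leqLHS](card_ord q.+1) -prod_nat_const; apply: leq_prod => l _.
  by apply: nY; rewrite /bump; have := ltn_ord l; lia.
apply: (@leq_trans (X * Y ^ q.+1)); last by rewrite leq_mul2l le orbT.
have qM : q.+1 <= M by nia.
have M0 : 0 < M by lia.
have XM' : (M - 1) * X <= M * Y.
  by apply: leq_trans XM _; rewrite leq_mul2l leq_pred orbT.
have := bernoulli_nat XM' qM; set y := Y ^ q.+1; set x := X ^ q.+1 => bern.
have h1 : x <= 2 * y.
  rewrite -(leq_pmul2l M0); apply: (@leq_trans (2 * ((M - q.+1) * x))).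
    by rewrite mulnA leq_mul2r; apply/orP; right; nia.
  by rewrite [X in _ <= X]mulnCA leq_mul2l bern orbT.
rewrite -(leq_pmul2l (isT : 0 < 2)) mulnA.
apply: leq_trans (leq_mul KX h1) _; by rewrite mulnCA.
Qed.

End Numeric.

Lemma mul_compl_mono x X S : x <= X -> x + X <= S -> x * (S - x) <= X * (S - X).
Proof.
move=> xX xXS; have [d Xd] : exists d, X = x + d by exists (X - x); lia.
have [e Se] : exists e, S = x + x + d + e by exists (S - x - X); lia.
have -> : S - x = x + d + e by lia.
have -> : S - X = x + e by lia.
by rewrite Xd; nia.
Qed.

Lemma ratio_leq_double a X Y : 0 < a -> a * X <= a.+1 * Y -> X <= 2 * Y.
Proof.
move=> a0 h; rewrite -(leq_pmul2l a0); apply: leq_trans h _.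
by rewrite mulSn mulnCA mul2n -addnn leq_add2r leq_pmull.
Qed.

(** Follows from $(1-\frac1{2a})(1+\frac1{4a})\le 1-\frac1{4a}\le 1-\frac1Y$. *)
Lemma ratio_leq_pred a X Y : 0 < a -> 4 * a <= Y -> 4 * a * X <= (4 * a).+1 * Y ->
  (2 * a - 1) * X <= 2 * a * Y.-1.
Proof.
case: a Y => [//|b] [|y]; first by rewrite mulnS.
move=> _ bY h; have -> : 2 * b.+1 - 1 = 2 * b + 1 by lia.
rewrite -(@leq_pmul2l (4 * b.+1)) // mulnCA.
apply: leq_trans (leq_mul (leqnn _) h) _; rewrite [y.+1.-1]/=.
have : (2 * b + 3) * (4 * b.+1) <= (2 * b + 3) * y.+1 by rewrite leq_mul2l bY orbT.
lia.
Qed.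

(** Here [x] is the size of the part left free by the triangle. By [mul_compl_mono] the choice
    [x = X] is best; the full box then exceeds the target by [t * X], which is at most the loss
    [Y ^ 2]. *)
Lemma tri_leq_loss f c t X Y a b x : x <= X -> X <= 2 * Y -> Y <= a -> Y <= b ->
  2 * t + 5 <= Y -> f + Y ^ 2 <= c + x * (X + a + b + Y - x - 2) ->
  f <= c + X * (a + b + Y - t - 2).
Proof.
move=> xX XY Ya Yb tY; rewrite -subnDA [x + 2]addnC subnDA => le.
have := @mul_compl_mono x X (X + a + b + Y - 2) xX ltac:(lia).
have -> : X + a + b + Y - 2 - X = a + b + Y - 2 by lia.
have tX : t * X <= Y ^ 2.
  apply: leq_trans (leq_mul (leqnn t) XY) _.
  by rewrite mulnCA mulnA expnS expn1 leq_mul2r; apply/orP; right; lia.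
have -> : X * (a + b + Y - t - 2) = X * (a + b + Y - 2) - t * X.
  by rewrite mulnC [X * _]mulnC -mulnBl; congr (_ * _); lia.
have : t * X <= X * (a + b + Y - 2).
  by rewrite mulnC leq_mul2l; apply/orP; right; lia.
lia.
Qed.

Lemma tri_leq_shrunk t X Y a b x : x <= X -> X <= 2 * Y -> Y <= a -> Y <= b ->
  2 * t + 5 <= Y -> x * (X + a + b + Y - t - x - 2) <= X * (a + b + Y - t - 2).
Proof.
move=> xX XY Ya Yb tY; rewrite -(subnDA x) [x + 2]addnC subnDA.
apply: leq_trans (@mul_compl_mono x X _ xX _) _; first by lia.
by rewrite leq_mul2l; apply/orP; right; lia.
Qed.

(** * The value of [m0] for nearly equal parts *)

Section Conclusion.
Variables (q t : nat) (n : nat -> nat).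
Let r := q.+3.
Let X := n 0.
Let Y := n q.+2.
Let K := t.+1 * r * (t.+1 * r.+1).
Let P := \prod_(l < q.+2) n l.
Let Q := \prod_(l < q.+2) (n l).-1.
Hypothesis n_noninc : forall i j, i <= j -> j < r -> n j <= n i.
(** The summands serve separate estimates: [4 * r ^ 2] for [ratio_leq_pred], the next for
    [rest_leq], [2 * K] for [prod_large]; the term [2 * t.+1] with the final 5 gives [Yt2]. *)
Hypothesis Y_large : 4 * r ^ 2 + 2 * (r ^ 3 + t.+1) + 2 * K + 5 <= Y.
Hypothesis XY : 4 * r ^ 2 * X <= (4 * r ^ 2).+1 * Y.

Let i0 : 'I_r := ord_max.

Let nX (i : 'I_r) : n i <= X. Proof. exact: n_noninc. Qed.
Let nY (i : 'I_r) : n i0 <= n i.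
Proof. by apply: n_noninc => //=; have := ltn_ord i; rewrite ltnS. Qed.
Let YX : Y <= X. Proof. exact: n_noninc. Qed.
Let X2Y : X <= 2 * Y.
Proof. by apply: ratio_leq_double XY; rewrite muln_gt0 expn_gt0. Qed.
Let Yt2 : 2 * t + 5 <= Y. Proof. by lia. Qed.
Let Yt : t + 5 <= n i0. Proof. by rewrite -/Y; lia. Qed.
Let XM : (2 * r ^ 2 - 1) * X <= 2 * r ^ 2 * Y.-1.
Proof. by apply: ratio_leq_pred; rewrite ?expn_gt0 //; lia. Qed.
Let M_large : 2 * q.+1 * q.+2 <= 2 * r ^ 2.
Proof. by rewrite -mulnA leq_mul2l /= expnS expn1 leq_mul // /r; lia. Qed.
Let nYl l : l < q.+2 -> Y <= n l.
Proof. by move=> lq; apply: n_noninc => //; lia. Qed.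
Let Y0 : 0 < Y. Proof. by lia. Qed.
Let PE : \prod_(l : 'I_r | l != i0) n l = P. Proof. exact: prod_neq_max. Qed.
Let QE : \prod_(l : 'I_r | l != i0) (n l).-1 = Q.
Proof. exact: (prod_neq_max _ (fun l => (n l).-1)). Qed.

Let PQ : q.+1 * X ^ q.+1 + q.+3 ^ 3 * X ^ q + t.+1 <= P - Q.
Proof. by apply: (rest_leq Y0 nYl XM M_large); lia. Qed.

Let rest_small : (r - 2) * X ^ (r - 2) + r ^ 3 * X ^ (r - 3) <=
  \prod_(l : 'I_r | l != i0) n l - \prod_(l : 'I_r | l != i0) (n l).-1 + (n i0 - t.+1).
Proof.
rewrite PE QE /r !subSS !subn0; apply: leq_trans (leq_addr _ _).
exact: leq_trans (leq_addr _ _) PQ.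
Qed.

Let P_large : t.+1 * r * (t.+1 * r.+1 * X ^ (r - 2)) <= \prod_(l : 'I_r | l != i0) n l.
Proof.
rewrite PE mulnA -/K /r !subSS subn0; apply: (prod_large Y0 nYl XM M_large) => //.
by apply: leq_trans YX; apply: leq_trans Y_large; rewrite -addnA addnCA leq_addr.
Qed.

(** Equals $sP-Q+n_r-s$ for $s=t+1$, grouped so that each truncated subtraction is exact. *)
Definition main_size := t * P + (P - Q) + (Y - t.+1).

Lemma m0_geq_main : main_size <= m0 r t.+1 n.
Proof. by have := m0_geq_hm (isT : 2 < r) nY Yt; rewrite PE QE. Qed.

Lemma m0_neq4 : r != 4 -> m0 r t.+1 n = main_size.
Proof.
move=> r4; apply/eqP; rewrite eqn_leq m0_geq_main andbT.
apply/bigmax_leqP => F /andP[nuF tauF].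
have := card_family_leq (isT : 2 < r) nY Yt nX rest_small P_large nuF tauF.
by rewrite PE QE; case=> // [] [re]; rewrite re in r4.
Qed.

(** For four parts this is the second term of the maximum, since $P=n_1n_2n_3$ and
    $n_2n_3-(n_2-1)(n_3-1)=n_2+n_3-1$. *)
Definition tri_main_size := t * P + X * (n 1 + n 2 + n 3 - t - 2).

Lemma m0_eq4 : q = 1 -> m0 r t.+1 n = maxn main_size tri_main_size.
Proof.
move=> q1; have rE : r = 4 by rewrite /r q1.
have r2 : r - 2 = 2 by rewrite rE.
have sumE (f : 'I_r -> nat) (g : nat -> nat) : (forall l, f l = g l) ->
    \sum_l f l = g 0 + g 1 + g 2 + g 3.
  move=> fg; rewrite (eq_bigr (fun l : 'I_r => g l)) => [|l _]; last exact: fg.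
  by rewrite -(big_mkord predT g) rE !big_nat_recr //= big_geq // add0n.
have Y3 : Y = n 3 by rewrite /Y q1.
have n1 : Y <= n 1 by apply: nYl; rewrite q1.
have n2 : Y <= n 2 by apply: nYl; rewrite q1.
apply/eqP; rewrite eqn_leq geq_max m0_geq_main /=; apply/andP; split.
  apply/bigmax_leqP => F /andP[nuF tauF]; rewrite leq_max.
  have := card_family_leq (isT : 2 < r) nY Yt nX rest_small P_large nuF tauF.
  rewrite PE QE -/Y; case=> [-> //|[_]|[_]].
    case=> i [j [k [ij ik jk le]]]; apply/orP; right.
    have [a aE] := tri_size4 (fun l : 'I_r => n l) rE ij ik jk.
    move: le; rewrite aE (sumE _ n) // r2 /tri_main_size -Y3.
    exact: tri_leq_loss (nX a) X2Y n1 n2 Yt2.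
  case=> i [j [k [b [ij ik jk nb le]]]]; apply/orP; right; apply: leq_trans le _.
  rewrite leq_add2l.
  have [a ->] := tri_size4 (shrunk n t b) rE ij ik jk.
  have sumE' : \sum_l shrunk n t b l = n 0 + n 1 + n 2 + n 3 - t.
    rewrite -(sumE (fun l => n l) n) // (bigD1 b) //= [in RHS](bigD1 b) //=.
    rewrite {1}/shrunk eqxx addnBAC; last by rewrite nb; apply: leq_trans Yt; apply: leq_addr.
    congr (_ + _ - _); apply: eq_bigr => l /negPf lb; by rewrite /shrunk lb.
  rewrite sumE' -Y3; apply: tri_leq_shrunk => //.
  by apply: leq_trans (nX a); rewrite /shrunk; case: ifP => // _; apply: leq_subr.
pose o k : 'I_r := inord k.
have oE k : k < 4 -> o k = k :> nat by move=> k4; rewrite inordK // q1.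
have on k l : k < 4 -> l < 4 -> k != l -> o k != o l.
  by move=> k4 l4; rewrite -(inj_eq val_inj) /= !oE.
(* The triangle sits on the last three parts, so that the free part is the largest one. *)
have := m0_geq_tri (isT : 2 < r) nY Yt (on 1 2 isT isT isT) (on 1 3 isT isT isT)
  (on 2 3 isT isT isT).
rewrite PE; apply: leq_trans; rewrite leq_add2l.
have oi0 : o 3 = i0 by apply: val_inj; rewrite /= oE // q1.
have os k : k < 3 -> shrunk n t i0 (o k) = n k.
  move=> k3; have k4 : k < 4 by apply: ltnW.
  by rewrite /shrunk -oi0 (negPf (on k 3 k4 isT _)) ?oE // neq_ltn k3.
rewrite /tri_size (os 1) // (os 2) // oi0 {2}/shrunk eqxx -oi0 (eq_bigl (pred1 (o 0))) => [|l]; last first.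
  rewrite /= -!(inj_eq val_inj) /= !oE //.
  have : l < 4 by rewrite -rE.
  by case: (nat_of_ord l) => [|[|[|[|]]]].
rewrite big_pred1_eq oi0 (os 0) // leq_mul2l; apply/orP; right.
have t3 : t <= n 3 by rewrite -Y3; apply: leq_trans Yt; apply: leq_addr.
rewrite /= q1; move: t3; clear; lia.
Qed.

End Conclusion.

(** * Transfer to rational and integer arithmetic *)

Unset Implicit Arguments.
Local Open Scope ring_scope.

(* n i = n_{i+1}; so n 0 = n_1 and n (r-1) = n_r. *)
Theorem theorem3p3 (r s : nat) :
  (3 <= r)%N -> (1 <= s)%N ->
  exists (delta : rat) (N : nat), (0 < delta)%R /\ (0 < N)%N /\
    forall n : nat -> nat,
      (forall i j : nat, (i <= j)%N -> (j < r)%N -> (n j <= n i)%N) ->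
      (N <= n r.-1)%N ->
      ((n 0%N)%:R <= (1 + delta) * (n r.-1)%:R :> rat)%R ->
      let P := (\prod_(l < r.-1) n l)%N in
      let Q := (\prod_(l < r.-1) (n l).-1)%N in
      let main : int := (s%:Z * P%:Z - Q%:Z + (n r.-1)%:Z - s%:Z)%R in
      (r != 4%N -> (m0 r s n)%:Z = main) /\
      (r = 4%N -> (m0 r s n)%:Z =
         Num.max main
           ((n 0%N)%:Z * (s%:Z * (n 1%N)%:Z * (n 2%N)%:Z
                        - ((n 1%N)%:Z - 1) * ((n 2%N)%:Z - 1)
                        + (n 3%N)%:Z - s%:Z))%R).
Proof.
case: r s => [|[|[|q]]] // [|t] // _ _.
set r := q.+3; pose K := (t.+1 * r * (t.+1 * r.+1))%N.
(* Clearing denominators with $\delta=1/(4r^2)$ yields the hypothesis [XY] on natural numbers, and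
   [N] is the bound in [Y_large]. *)
exists (4 * r ^ 2)%:R^-1, (4 * r ^ 2 + 2 * (r ^ 3 + t.+1) + 2 * K + 5)%N.
split; first by rewrite invr_gt0 ltr0n muln_gt0 expn_gt0.
split; first by rewrite addnS.
move=> n n_noninc Y_large XY P Q main.
have {}XY : (4 * r ^ 2 * n 0 <= (4 * r ^ 2).+1 * n q.+2)%N.
  move: XY; rewrite -/r [r.-1]/=; move: (n 0%N) (n q.+2) => X Y.
  have : (0 < 4 * r ^ 2)%N by rewrite muln_gt0 expn_gt0.
  move: (4 * r ^ 2)%N => a a0; have a0' : 0 < a%:R :> rat by rewrite ltr0n.
  rewrite -(ler_pM2l a0') mulrA mulrDr mulr1 divff ?gt_eqF //.
  by rewrite natr1 -!natrM ler_nat.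
have QP : (Q <= P)%N by apply: leq_prod => l _; apply: leq_pred.
have mainE : main = (main_size q t n)%:Z.
  rewrite /main /main_size -/P -/Q [r.-1]/=.
  have : (t.+1 <= n q.+2)%N by move: Y_large; rewrite -/r [r.-1]/=; lia.
  move: (n q.+2) QP => Y QP tY; nia.
split=> [r4|[q1]]; first by rewrite m0_neq4.
rewrite m0_eq4 // mainE; subst q.
have -> : (n 0%N)%:Z * (t.+1%:Z * (n 1%N)%:Z * (n 2%N)%:Z
    - ((n 1%N)%:Z - 1) * ((n 2%N)%:Z - 1) + (n 3%N)%:Z - t.+1%:Z) = (tri_main_size 1 t n)%:Z.
  rewrite /tri_main_size !big_ord_recr big_ord0 /= mul1n.
  have n1 : (n 3 <= n 1)%N by apply: n_noninc.
  have : (t + 2 <= n 3)%N by move: Y_large; rewrite /=; lia.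
  rewrite PoszD !PoszM => t3.
  have -> : Posz (n 1 + n 2 + n 3 - t - 2)%N = (n 1%N)%:Z + (n 2%N)%:Z + (n 3%N)%:Z - t%:Z - 2 by lia.
  have -> : t.+1%:Z = t%:Z + 1 by lia.
  ring.
by rewrite /Num.max; case: ltP => h; congr Posz; lia.
Qed.
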